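(* Suppose $\sigma>2M(N-2)$. Let $\{Z^{(k)}\}_{k\ge0}$ be a sequence generated by the inexact algorithm PBCD and let $\{\bar Z^{(k)}\}_{k\ge1}$ be the associated block optimal sequence (both defined in the context). Suppose that (A1) the sequence $\{F(\bar Z^{(k)})\}$ is non-increasing and hence converges to some $\overline F>0$, and (A2) $\sum_{k=1}^\infty\Vert\bar Z^{(k)}-Z^{(k)}\Vert_{\mathrm F}<\infty$. Assume also that $F(\bar Z^{(k)})>\overline F$ for all $k\ge1$. Then: (1) the sequence $\{Z^{(k)}\}$ converges to a KKT point of problem (P); (2) let $\overline Z$ be a global minimizer of (P), let $\bar\eta$, a neighborhood $\overline{\mathcal U}$ of $\overline Z$ and $\bar\varphi\in\Phi_{\bar\eta}$ be as in the Kurdyka-Łojasiewicz property of $F$ at $\overline Z$ (stated in the context), let $r>0$ be such that the closed ball $B_r(\overline Z)=\{Z:\Vert Z-\overline Z\Vert_{\mathrm F}\le r\}$ is contained in $\overline{\mathcal U}$, and let $p$ be a constant with $p>\frac{1}{2\sqrt{C_0}}$. If further $F(\overline Z)<F(Z^{(0)})<F(\overline Z)+\bar\eta$ and $$\tilde C_1\,\bar\varphi\big(F(Z^{(0)})-F(\overline Z)\big)+\tilde C_2\sqrt{F(Z^{(0)})-F(\overline Z)}+\tilde C_3\sum_{k=1}^\infty\Vert\bar Z^{(k)}-Z^{(k)}\Vert_{\mathrm F}+\Vert Z^{(0)}-\overline Z\Vert_{\mathrm F}\le r,$$ then $\{Z^{(k)}\}$ converges to a global minimizer of (P).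
   Context: Problem. Let $N\ge3$, $d\in\{1,2,3\}$, $\Omega\subseteq\mathbb R^d$ a bounded domain partitioned into $K$ non-overlapping elements $e_1,\dots,e_K$ with volumes $|e_k|$; $e=(|e_1|,\dots,|e_K|)^\top$. Let $\rho:\Omega\to\mathbb R$ be the single-particle density (nonnegative), $\varrho=(\varrho_1,\dots,\varrho_K)^\top$ with $\varrho_k=\frac1{|e_k|}\int_{e_k}\rho(r)\,dr\ge0$. Put $\Lambda=\mathrm{Diag}(\varrho)$, $\Xi=\mathrm{Diag}(e)$, and let $C$ be the $K\times K$ matrix with zero diagonal and off-diagonal entries $c_{jk}=\frac{1}{|e_j||e_k|}\int_{e_k}\int_{e_j}\frac{1}{|r-r'|}\,dr\,dr'$. Let $\mathbf 1\in\mathbb R^K$ be the all-one vector and $\beta>0$. For matrices, $\langle\cdot,\cdot\rangle$ is the trace inner product, $\Vert\cdot\Vert_{\mathrm F}$ the Frobenius norm (also used for tuples in $(\mathbb R^{K\times K})^{N-1}$), $\Vert\cdot\Vert_2$ the matrix 2-norm; for vectors, $\Vert\cdot\Vert_\infty$ is the max norm; $X\ge0$ is entrywise. Block variables are $Z=(X_2,\dots,X_N)\in(\mathbb R^{K\times K})^{N-1}$. Define $\mathcal B:\mathbb R^{K\times K}\to\mathbb R^{2K+1}$ by $\mathcal B(W)=\big[e^\top W^\top,\ \varrho^\top\Xi W,\ \mathrm{Tr}(W)\big]^\top$, $b=[\mathbf 1^\top,\varrho^\top,0]^\top$, and $\mathcal S=\{W\in\mathbb R^{K\times K}:\mathcal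 B(W)=b,\ W\ge0\}$. Define $$f_\beta(X_2,\dots,X_N)=\sum_{2\le i\le N}\langle X_i,\Lambda\Xi C\Xi\rangle+\sum_{2\le i<j\le N}\langle X_i,\Xi\Lambda X_j\Xi C\Xi\rangle+\beta\sum_{2\le i<j\le N}\langle X_i,X_j\rangle.$$ Problem (P) is: minimize $f_\beta(X_2,\dots,X_N)$ subject to $X_i\in\mathcal S$, $i=2,\dots,N$. Let $F(Z)=f_\beta(Z)+\sum_{i=2}^N\delta_{\mathcal S}(X_i)$, where $\delta_{\mathcal S}$ is $0$ on $\mathcal S$ and $+\infty$ elsewhere. KKT point. $(X_i)_{i=2}^N$ is a KKT point of (P) if there exist $\lambda_i\in\mathbb R^{2K+1}$, $\Phi_i\in\mathbb R^{K\times K}$ such that for every $i\in\{2,\dots,N\}$: $$\Lambda\Xi C\Xi+\Xi\Lambda\Big(\sum_{j\ne i}X_j\Big)\Xi C\Xi+\beta\sum_{j\ne i}X_j-\mathcal B^*(\lambda_i)-\Phi_i=0,$$ $\mathcal B(X_i)=b$, $X_i\ge0$, $\Phi_i\ge0$, $\Phi_i\circ X_i=0$, where $\circ$ is the entrywise product and $\mathcal B^*$ the adjoint of $\mathcal B$. Algorithm PBCD (inexact). Given $\sigma>0$ and $Z^{(0)}=(X_i^{(0)})_{i=2}^N\in(\mathbb R^{K\times K})^{N-1}$, for $k=0,1,2,\dots$ and successively $i=2,\dots,N$, the matrix $X_i^{(k+1)}\in\mathbb R^{K\times K}$ is an inexact (possibly infeasible) solution of $$\min_{X_i\in\mathcal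 S}\ f_\beta\big(X_{<i}^{(k+1)},X_i,X_{>i}^{(k)}\big)+\frac\sigma2\Vert X_i-X_i^{(k)}\Vert_{\mathrm F}^2,$$ where $X_{<i}=(X_2,\dots,X_{i-1})$, $X_{>i}=(X_{i+1},\dots,X_N)$; $Z^{(k)}=(X_i^{(k)})_{i=2}^N$. No accuracy is prescribed on the inexact solutions beyond the hypotheses of the claim. The block optimal sequence is $\bar Z^{(k+1)}=(\bar X_i^{(k+1)})_{i=2}^N$, $k\ge0$, where $\bar X_i^{(k+1)}$ is the unique exact minimizer of the displayed block problem (with the actual iterates $X_{<i}^{(k+1)},X_i^{(k)},X_{>i}^{(k)}$ as data). Constants. $M=\Vert\varrho\Vert_\infty\Vert e\Vert_\infty^3\Vert C\Vert_2+\beta$, $C_0=\frac\sigma2-M(N-2)$, $C_1=\frac{\sigma+3MN}{2}-2M$, $C_2=(N-1)C_1$, $C_3=(\sigma+M(N-1))\sqrt{N-1}$; and for $p>\frac1{2\sqrt{C_0}}$: $\tilde C_0=\sqrt{C_0}-\frac1{2p}$, $\tilde C_1=\frac{pC_3}{\tilde C_0}$, $\tilde C_2=\big(\frac{1}{2p\tilde C_0}+1\big)\frac1{\sqrt{C_0}}$, $\tilde C_3=\frac1{\tilde C_0}\big(\frac1{2p}+2\sqrt{C_2}\big)+\sqrt{C_2}\,\tilde C_2+1$. Subdifferential. For $F(Z)<\infty$, the Fréchet subdifferential $\widehat\partial F(Z)$ is the set of $U$ with $\liminf_{Y\ne Z,\,Y\to Z}\frac{F(Y)-F(Z)-\langle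 U,Y-Z\rangle}{\Vert Y-Z\Vert_{\mathrm F}}\ge0$; it is empty if $F(Z)=\infty$. The limiting subdifferential $\partial F(Z)$ is the set of $U$ for which there are $Y^{(k)}\to Z$ with $F(Y^{(k)})\to F(Z)$ and $U^{(k)}\in\widehat\partial F(Y^{(k)})$ with $U^{(k)}\to U$. Kurdyka-Łojasiewicz (KL) property. For $\eta\in(0,\infty]$, $\Phi_\eta$ is the class of concave continuous $\varphi:[0,\eta)\to[0,\infty)$ with $\varphi(0)=0$, $\varphi\in C^1((0,\eta))$ and $\varphi'(s)>0$ for $s\in(0,\eta)$. $F$ (the sum of a real analytic function and semi-algebraic indicator functions) has the KL property at $\overline Z$: there exist $\bar\eta\in(0,\infty]$, a neighborhood $\overline{\mathcal U}$ of $\overline Z$ and $\bar\varphi\in\Phi_{\bar\eta}$ such that for all $Z\in\overline{\mathcal U}$ with $F(\overline Z)<F(Z)<F(\overline Z)+\bar\eta$, $\ \bar\varphi'(F(Z)-F(\overline Z))\cdot\mathrm{dist}(0,\partial F(Z))\ge1$, where $\mathrm{dist}(u,S)=\inf_{v\in S}\Vert u-v\Vert_{\mathrm F}$.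
   Formalization: Part (2) additionally assumes F(Z̄^(1)) ≤ F(Z^(0)), i.e. the monotone sequence in (A1) starts at Z̄^(0)=Z^(0); without it an arbitrarily inexact first sweep can leave the KL window and converge to a non-minimizing saddle, so the claim as worded fails. *)

(* Defs.v *)
From HB Require Import structures.
From mathcomp Require Import all_boot all_order all_algebra.
From mathcomp Require Import all_classical all_reals all_analysis.

Set Implicit Arguments.
Unset Strict Implicit.
Unset Printing Implicit Defensive.

Import Order.TTheory GRing.Theory Num.Theory.
Import numFieldNormedType.Exports.

Local Open Scope classical_set_scope.
Local Open Scope ring_scope.

(* Points of R^d are d-tuples; [leb_box] below characterizes [leb]. *)
Section LebesgueMeasure.
Context {R : realType}.

Definition cons_tuple n (p : n.-tuple R * R) : n.+1.-tuple R :=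
  [tuple of p.2 :: p.1].

Lemma measurable_cons_tuple n :
  measurable_fun [set: n.-tuple R * R] (@cons_tuple n).
Proof. by apply: measurable_cons. Qed.

Section Step.
Context (n : nat) (m : {measure set (n.-tuple R) -> \bar R}).

Definition leb_step : set (n.+1.-tuple R) -> \bar R :=
  pushforward (m \x lebesgue_measure)%E (@cons_tuple n).

Let leb_step0 : leb_step set0 = 0%E.
Proof. by rewrite /leb_step /pushforward preimage_set0 measure0. Qed.

Let leb_step_ge0 A : (0 <= leb_step A)%E.
Proof. by rewrite /leb_step /pushforward measure_ge0. Qed.

Let leb_step_sigma_additive : semi_sigma_additive leb_step.
Proof.
move=> F mF tF mUF; rewrite /leb_step /pushforward preimage_bigcup.
apply: measure_semi_sigma_additive.
- by move=> i; rewrite -[X in measurable X]setTI; exact: measurable_cons_tuple.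
- apply/trivIsetP => /= i j _ _ ij; rewrite -preimage_setI.
  by move/trivIsetP : tF => /(_ _ _ _ _ ij) ->//; rewrite preimage_set0.
- rewrite -preimage_bigcup -[X in measurable X]setTI.
  exact: measurable_cons_tuple.
Qed.

HB.instance Definition _ := isMeasure.Build _ _ _ leb_step
  leb_step0 leb_step_ge0 leb_step_sigma_additive.

End Step.

Fixpoint leb (d : nat) : {measure set (d.-tuple R) -> \bar R} :=
  match d with
  | 0 => \d_ [tuple]
  | n.+1 => leb_step (leb n)
  end.

Lemma measurable_box d (A : 'I_d -> set R) : (forall i, measurable (A i)) ->
  measurable [set x : d.-tuple R | forall i, A i (tnth x i)].
Proof.
move=> mA; rewrite [X in measurable X](_ : _ =
  \bigcap_(i in [set: 'I_d]) ((fun x => tnth x i) @^-1` A i)); last first.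
  by apply/seteqP; split => x /= h i; [move=> _; exact: h | exact: h].
apply: fin_bigcap_measurable => // i _.
by rewrite -[X in measurable X]setTI; exact: measurable_tnth.
Qed.

Lemma leb_box d (A : 'I_d -> set R) : (forall i, measurable (A i)) ->
  leb d [set x : d.-tuple R | forall i, A i (tnth x i)]
    = (\prod_(i < d) lebesgue_measure (A i))%E.
Proof.
elim: d A => [|n IH] A mA.
  rewrite big_ord0 /= diracE mem_set//= => -[].
  by [].
rewrite /= /leb_step /pushforward /= (_ : _ @^-1` _ =
  [set x : n.-tuple R | forall i, A (lift ord0 i) (tnth x i)] `*` A ord0).
  have mB : measurable [set x : n.-tuple R |
      forall i, A (lift ord0 i) (tnth x i)].
    exact: (@measurable_box n (fun i => A (lift ord0 i))).
  rewrite product_measure1E//; last exact: mA.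
  by rewrite big_ord_recl (IH (fun i => A (lift ord0 i)))// muleC.
apply/seteqP; split => [[x y] /= h|[x y] /= [h1 h2] i].
  split; last exact: (h ord0).
  by move=> i; have := h (lift ord0 i); rewrite tnthS.
by case: (unliftP ord0 i) => [j ->|->] //; rewrite tnthS.
Qed.

End LebesgueMeasure.

Section Norms.
Context {R : realType}.

Definition mxdot m n (A B : 'M[R]_(m, n)) : R := \tr (A^T *m B).

Definition fro m n (A : 'M[R]_(m, n)) : R := Num.sqrt (mxdot A A).

Definition norm2_mx m n (A : 'M[R]_(m, n)) : R :=
  sup [set fro (A *m x) | x in [set x : 'cV[R]_n | fro x <= 1]].

Definition nonneg_mx m n (A : 'M[R]_(m, n)) : Prop := forall i j, 0 <= A i j.

(* The block X_i, 2 <= i <= N, is stored at the index i - 2 of 'I_(N - 1). *)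
Definition blocks (N K : nat) := {ffun 'I_N.-1 -> 'M[R]_K}.

Definition bdot N K (U V : blocks N K) : R := \sum_i mxdot (U i) (V i).

Definition bnorm N K (Z : blocks N K) : R := Num.sqrt (bdot Z Z).

Definition bconverges N K (Z : nat -> blocks N K) (Zlim : blocks N K) : Prop :=
  (fun k => bnorm (Z k - Zlim)) @ \oo --> (0 : R).

End Norms.
Arguments blocks : clear implicits.

Section Discretization.
Context {R : realType}.

Definition edist d (x y : d.-tuple R) : R :=
  Num.sqrt (\sum_(i < d) (tnth x i - tnth y i) ^+ 2).

Definition bounded_domain d (Omega : set (d.-tuple R)) : Prop :=
  let O := [set (\row_i tnth x i : 'rV[R]_d) | x in Omega] in
  [/\ O !=set0, open O, connected O & bounded_set O].

(* Partition up to null sets, so that the elements may be taken open, closed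
   or half-open. *)
Definition partitioned d K (Omega : set (d.-tuple R))
    (el : 'I_K -> set (d.-tuple R)) : Prop :=
  [/\ forall k, measurable (el k) /\ (0 < leb d (el k))%E,
      forall k, leb d (el k `\` Omega) = 0%E,
      leb d (Omega `\` \bigcup_k el k) = 0%E
    & forall j k, j != k -> leb d (el j `&` el k) = 0%E].

Definition volumes d K (el : 'I_K -> set (d.-tuple R)) : 'cV[R]_K :=
  \col_k fine (leb d (el k)).

Definition density_averages d K (el : 'I_K -> set (d.-tuple R))
    (rho : d.-tuple R -> R) : 'cV[R]_K :=
  \col_k ((volumes el k 0)^-1 * \int[leb d]_(r in el k) rho r).

(* [edist r r' = 0] only on a null set since j != k.  The double integral is
   finite except for wild pairs of elements in dimension d = 1, where [fine]
   returns 0. *)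
Definition coulomb d K (el : 'I_K -> set (d.-tuple R)) : 'M[R]_K :=
  \matrix_(j, k) if j == k then 0 else
    (volumes el j 0 * volumes el k 0)^-1 *
    fine (\int[leb d]_(r' in el k) \int[leb d]_(r in el j)
            ((edist r r')^-1)%:E)%E.

End Discretization.

Section Problem.
Context {R : realType} (N K : nat).
Variables (e vrho : 'cV[R]_K) (C : 'M[R]_K) (beta : R).

Let Lambda : 'M[R]_K := diag_mx vrho^T.
Let Xi : 'M[R]_K := diag_mx e^T.

(* Elements of R^(2K+1) are rows of length K + K + 1. *)
Definition cB (W : 'M[R]_K) : 'rV[R]_(K + K + 1) :=
  row_mx (row_mx (e^T *m W^T) (vrho^T *m Xi *m W)) (\tr W)%:M.

Definition cb : 'rV[R]_(K + K + 1) :=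
  row_mx (row_mx (const_mx 1) vrho^T) 0.

Definition cB_adj (lam : 'rV[R]_(K + K + 1)) : 'M[R]_K :=
  \matrix_(i, j) mxdot (cB (delta_mx i j)) lam.

Lemma cB_adjP W lam : mxdot (cB W) lam = mxdot W (cB_adj lam).
Proof.
have cBD U V : cB (U + V) = cB U + cB V.
  by rewrite /cB linearD !mulmxDr linearD /= raddfD !add_row_mx.
have cBZ a U : cB (a *: U) = a *: cB U.
  rewrite /cB linearZ /= -!scalemxAr linearZ /= -scale_scalar_mx.
  by rewrite !scale_row_mx.
have cB0 : cB 0 = 0 by rewrite -[X in cB X](scale0r 0) cBZ scale0r.
have dD (U V : 'rV_(K + K + 1)) : mxdot (U + V) lam = mxdot U lam + mxdot V lam.
  by rewrite /mxdot linearD /= mulmxDl linearD.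
have dZ a (U : 'rV_(K + K + 1)) : mxdot (a *: U) lam = a * mxdot U lam.
  by rewrite /mxdot linearZ /= -scalemxAl linearZ.
have d0 : mxdot (0 : 'rV_(K + K + 1)) lam = 0.
  by rewrite /mxdot trmx0 mul0mx linear0.
have L0 : mxdot (cB 0) lam = 0 by rewrite cB0 d0.
have LD : {morph (fun U => mxdot (cB U) lam) : U V / U + V >-> U + V}.
  by move=> U V /=; rewrite cBD dD.
rewrite [in LHS](matrix_sum_delta W) (big_morph _ LD L0).
transitivity (\sum_i \sum_j W i j * cB_adj lam i j).
  apply: eq_bigr => i _; rewrite (big_morph _ LD L0); apply: eq_bigr => j _.
  by rewrite cBZ dZ mxE.
rewrite /mxdot /mxtrace exchange_big /=; apply: eq_bigr => j _.
by rewrite [RHS]mxE; apply: eq_bigr => i _; rewrite [W^T _ _]mxE.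
Qed.

Definition cS : set 'M[R]_K := [set W | cB W = cb /\ nonneg_mx W].

Definition fbeta (X : blocks R N K) : R :=
  \sum_i mxdot (X i) (Lambda *m Xi *m C *m Xi)
  + \sum_(i < N.-1) \sum_(j < N.-1 | (i < j)%N)
      mxdot (X i) (Xi *m Lambda *m X j *m Xi *m C *m Xi)
  + beta * \sum_(i < N.-1) \sum_(j < N.-1 | (i < j)%N) mxdot (X i) (X j).

Definition feasible (X : blocks R N K) : Prop := forall i, cS (X i).

Definition indicator (W : 'M[R]_K) : \bar R :=
  if W \in cS then 0%E else +oo%E.

Definition cF (X : blocks R N K) : \bar R :=
  ((fbeta X)%:E + \sum_i indicator (X i))%E.

Definition global_minimizer (X : blocks R N K) : Prop :=
  feasible X /\ forall Y, feasible Y -> fbeta X <= fbeta Y.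

Definition KKT_point (X : blocks R N K) : Prop :=
  exists (lam : 'I_N.-1 -> 'rV[R]_(K + K + 1)) (Phi : 'I_N.-1 -> 'M[R]_K),
  forall i : 'I_N.-1,
    [/\ Lambda *m Xi *m C *m Xi
          + Xi *m Lambda *m (\sum_(j | j != i) X j) *m Xi *m C *m Xi
          + beta *: (\sum_(j | j != i) X j)
          - cB_adj (lam i) - Phi i = 0,
        cB (X i) = cb,
        nonneg_mx (X i),
        nonneg_mx (Phi i)
      & forall a b, Phi i a b * X i a b = 0].

Variable sigma : R.

Definition block_objective (Zold Znew : blocks R N K) (i : 'I_N.-1)
    (W : 'M[R]_K) : R :=
  fbeta [ffun j : 'I_N.-1 => if (j < i)%N then Znew j
                   else if j == i then W else Zold j]
  + sigma / 2 * fro (W - Zold i) ^+ 2.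

(* Inexact PBCD prescribes no accuracy, not even feasibility, for its iterates,
   so every sequence [Z] is generated by it; [Z] matters only through the data
   of the block problems, whose exact minimizers form [Zbar].  [Zbar 0] is
   unconstrained and never used. *)
Definition block_optimal_sequence (Z Zbar : nat -> blocks R N K) : Prop :=
  forall (k : nat) (i : 'I_N.-1),
    cS (Zbar k.+1 i) /\
    forall W, cS W ->
      block_objective (Z k) (Z k.+1) i (Zbar k.+1 i)
        <= block_objective (Z k) (Z k.+1) i W.

Definition cst_M : R := `|vrho| * `|e| ^+ 3 * norm2_mx C + beta.
Definition cst_C0 : R := sigma / 2 - cst_M * (N%:R - 2).
Definition cst_C1 : R := (sigma + 3 * cst_M * N%:R) / 2 - 2 * cst_M.
Definition cst_C2 : R := (N%:R - 1) * cst_C1.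
Definition cst_C3 : R :=
  (sigma + cst_M * (N%:R - 1)) * Num.sqrt (N%:R - 1).

Variable p : R.

Definition cst_tC0 : R := Num.sqrt cst_C0 - 1 / (2 * p).
Definition cst_tC1 : R := p * cst_C3 / cst_tC0.
Definition cst_tC2 : R :=
  (1 / (2 * p * cst_tC0) + 1) * (1 / Num.sqrt cst_C0).
Definition cst_tC3 : R :=
  1 / cst_tC0 * (1 / (2 * p) + 2 * Num.sqrt cst_C2)
  + Num.sqrt cst_C2 * cst_tC2 + 1.

End Problem.

Section KL.
Context {R : realType} (N K : nat).
Implicit Types (F : blocks R N K -> \bar R) (Z U Y : blocks R N K).

Definition liminf_punctured (q : blocks R N K -> \bar R) Z : \bar R :=
  ereal_sup [set ereal_inf [set q Y | Y in
                              [set Y | Y != Z /\ bnorm (Y - Z) < delta]]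
            | delta in [set delta : R | 0 < delta]].

Definition frechet_subdiff F Z : set (blocks R N K) :=
  [set U | (F Z < +oo)%E /\
    (0 <= liminf_punctured (fun Y =>
       (F Y - F Z - (bdot U (Y - Z))%:E) * ((bnorm (Y - Z))^-1)%:E) Z)%E].

Definition limiting_subdiff F Z : set (blocks R N K) :=
  [set U | exists Y V : nat -> blocks R N K,
    [/\ bconverges Y Z,
        (fun k => F (Y k)) @ \oo --> F Z,
        forall k, frechet_subdiff F (Y k) (V k)
      & bconverges V U]].

Definition bdist U (S : set (blocks R N K)) : \bar R :=
  ereal_inf [set (bnorm (U - V))%:E | V in S].

Definition desingularizing (eta : \bar R) (phi : R -> R) : Prop :=
  let D := [set s : R | 0 <= s /\ (s%:E < eta)%E] in
  [/\ forall s, D s -> 0 <= phi s,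
      forall s t a, D s -> D t -> 0 <= a <= 1 ->
        a * phi s + (1 - a) * phi t <= phi (a * s + (1 - a) * t),
      {within D, continuous phi},
      phi 0 = 0
    & forall s, D s -> 0 < s ->
        [/\ derivable phi s 1, {for s, continuous (derive1 phi)} & 0 < derive1 phi s]].

Definition KL_property_with F (Zb : blocks R N K)
    (eta : \bar R) (U : set (blocks R N K)) (phi : R -> R) : Prop :=
  [/\ (0 < eta)%E,
      exists2 delta : R, 0 < delta & [set Z | bnorm (Z - Zb) < delta] `<=` U,
      desingularizing eta phi
    & forall Z, U Z -> (F Zb < F Z)%E -> (F Z < F Zb + eta)%E ->
        (1 <= (derive1 phi (fine (F Z) - fine (F Zb)))%:E
              * bdist (0 : blocks R N K)%R (limiting_subdiff F Z))%E].

End KL.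

(* Main.v *)
Require Import Defs.
From HB Require Import structures.
From mathcomp Require Import all_boot all_order all_algebra.
From mathcomp Require Import all_classical all_reals all_analysis.
From mathcomp Require Import measurable_realfun ring lra.

Set Implicit Arguments.
Unset Strict Implicit.
Unset Printing Implicit Defensive.

Import Order.TTheory GRing.Theory Num.Theory.
Import numFieldNormedType.Exports.

Local Open Scope classical_set_scope.
Local Open Scope ring_scope.

(** The objective is a quadratic function: its gradient is affine, and its
    Hessian [hess] couples different blocks only, through one self-adjoint
    operator [interaction] whose norm is at most [cst_M]. Self-adjointness
    rests on the symmetry of the Coulomb matrix, that is, on Tonelli's theorem.
    The feasible set is a polyhedron. A point [X] is called critical up to [xi]
    when [xi] lies in the gradient plus the normal cone at [X]; such an [xi] is
    a limiting subgradient ([critical_limiting_subdiff]).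

    Two facts about one sweep come from the optimality conditions of the block
    problems. The block optimum is critical up to a [residual] whose norm is at
    most [cst_C3] times the length of the step plus the errors
    ([bnorm_residual]), because the data of the block problem differ from the
    block optimum by just these. And the objective decreases by [cst_C0] times
    the squared step, up to [cst_C2] times the squared errors ([descent]).

    Let [psi] be a concave function of the height of the value above a
    reference level, with slope at least the inverse of the norm of the
    residual. By concavity the decrease of the value, hence the squared step,
    is at most the previous step (plus errors) times the decrease of [psi]. The
    inequality of arithmetic and geometric means ([lojasiewicz_step]) and a
    telescoping sum ([length_bound]) then bound the total length of the
    trajectory by its first step, the sum of the errors and the initial [psi].

    For the first claim the level is the limit of the values, and [psi] is a
    multiple of a square root. The required inequality, height at most a
    constant times the squared norm of the residual, is proved directly
    ([lojasiewicz_feasible]). On the affine hull of a face the objective is a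
    quadratic polynomial of one vector, for which the inequality is linear
    algebra: either the gradient stays away from zero, or the polynomial
    differs from its unique critical value by at most a multiple of the squared
    gradient. A face is determined by the set of vanishing entries, so finitely
    many constants occur, and they serve for all points at once. The trajectory
    therefore has finite length and converges; the residuals tend to zero, so the limit satisfies the
    variational inequality of the problem, and Farkas' lemma turns this into
    multipliers ([critical_KKT]).

    For the second claim [psi] is built from the desingularizing function at
    the global minimizer. The inequality is available only inside the ball, and
    the smallness assumption is what keeps the trajectory there: by induction,
    the length travelled so far is too short to leave it ([trapped]). The limit
    is critical and lies in the ball, where a critical value cannot exceed the
    minimum: the product of slope and distance in the inequality would vanish
    ([trapped_limit_minimizer]). *)

(** * Trace inner products and Frobenius norms *)

Section PositiveSemidefiniteForms.
Context {R : realType} (V : lmodType R) (dot : V -> V -> R).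
Context (dotC : forall u v, dot u v = dot v u).
Context (dotDl : forall u v w, dot (u + v) w = dot u w + dot v w).
Context (dotZl : forall a u v, dot (a *: u) v = a * dot u v).
Context (dot_ge0 : forall u, 0 <= dot u u).

(** The form may be degenerate: where [dot v v] vanishes, positivity along
    [u + t *: v] for large negative [t] forces [dot u v] to vanish as well. *)
Lemma cauchy_schwarz_form u v :
  dot u v <= Num.sqrt (dot u u) * Num.sqrt (dot v v).
Proof.
have dotDr x y z : dot x (y + z) = dot x y + dot x z.
  by rewrite dotC dotDl !(dotC x).
have dotZr a x y : dot x (a *: y) = a * dot x y by rewrite dotC dotZl dotC.
have quad s t : 0 <= s ^+ 2 * dot u u + 2 * s * t * dot u v + t ^+ 2 * dot v v.
  have := dot_ge0 (s *: u + t *: v).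
  rewrite !dotDl !dotDr !dotZl !dotZr (dotC v u); set b := dot u v.
  by move=> h; apply: (le_trans h); rewrite le_eqVlt; apply/orP; left;
    apply/eqP; ring.
have [uv0|uv0] := leP (dot u v) 0.
  by apply: (le_trans uv0); rewrite mulr_ge0 ?sqrtr_ge0.
rewrite -sqrtrM ?dot_ge0// -[leLHS]ger0_norm ?(ltW uv0)// -sqrtr_sqr.
rewrite ler_wsqrtr//.
have u0 := dot_ge0 u; have v0 := dot_ge0 v.
have [vv0|vv0] := eqVneq (dot v v) 0.
  have := quad 1 (- (dot u u + 1) / dot u v).
  rewrite vv0 mulr0 addr0 expr1n mul1r mulr1 -mulrA divfK ?gt_eqF//.
  by move=> h; exfalso; nra.
have := quad (dot v v) (- dot u v).
have {vv0} : 0 < dot v v by rewrite lt_neqAle eq_sym vv0.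
move=> h1 h2; have : 0 <= dot v v * (dot u u * dot v v - dot u v ^+ 2).
  by apply: le_trans h2 _; rewrite le_eqVlt; apply/orP; left; apply/eqP; ring.
by rewrite pmulr_rge0// subr_ge0.
Qed.

Lemma triangle_form u v :
  Num.sqrt (dot (u + v) (u + v)) <= Num.sqrt (dot u u) + Num.sqrt (dot v v).
Proof.
rewrite -[leRHS]ger0_norm ?addr_ge0 ?sqrtr_ge0// -sqrtr_sqr ler_wsqrtr//.
rewrite sqrrD !sqr_sqrtr ?dot_ge0// dotDl !(dotC _ (u + v)) !dotDl (dotC v u).
by have := cauchy_schwarz_form u v; lra.
Qed.

End PositiveSemidefiniteForms.

Section TraceInnerProduct.
Context {R : realType}.

Section Matrices.
Context {m n : nat}.
Implicit Types A B D : 'M[R]_(m, n).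

Lemma mxdotE A B : mxdot A B = \sum_i \sum_j A i j * B i j.
Proof.
rewrite /mxdot /mxtrace exchange_big /=; apply: eq_bigr => j _.
by rewrite mxE; apply: eq_bigr => i _; rewrite mxE.
Qed.

Lemma mxdotC A B : mxdot A B = mxdot B A.
Proof.
by rewrite !mxdotE; apply: eq_bigr => i _; apply: eq_bigr => j _; rewrite mulrC.
Qed.

Lemma mxdotDl A B D : mxdot (A + B) D = mxdot A D + mxdot B D.
Proof. by rewrite /mxdot linearD /= mulmxDl linearD. Qed.

Lemma mxdotZl a A B : mxdot (a *: A) B = a * mxdot A B.
Proof. by rewrite /mxdot linearZ /= -scalemxAl linearZ. Qed.

Lemma mxdotDr A B D : mxdot A (B + D) = mxdot A B + mxdot A D.
Proof. by rewrite mxdotC mxdotDl !(mxdotC A). Qed.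

Lemma mxdotZr a A B : mxdot A (a *: B) = a * mxdot A B.
Proof. by rewrite mxdotC mxdotZl mxdotC. Qed.

Lemma mxdotNl A B : mxdot (- A) B = - mxdot A B.
Proof. by rewrite -scaleN1r mxdotZl mulN1r. Qed.

Lemma mxdotNr A B : mxdot A (- B) = - mxdot A B.
Proof. by rewrite -scaleN1r mxdotZr mulN1r. Qed.

Lemma mxdot0l A : mxdot 0 A = 0.
Proof. by rewrite -(scale0r A) mxdotZl mul0r. Qed.

Lemma mxdot0r A : mxdot A 0 = 0.
Proof. by rewrite mxdotC mxdot0l. Qed.

Lemma mxdot_suml I r (P : pred I) (F : I -> 'M[R]_(m, n)) A :
  mxdot (\sum_(i <- r | P i) F i) A = \sum_(i <- r | P i) mxdot (F i) A.
Proof.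
by apply: (big_morph (fun X => mxdot X A)) => [X Y|]; rewrite ?mxdotDl ?mxdot0l.
Qed.

Lemma mxdot_ge0 A : 0 <= mxdot A A.
Proof.
by rewrite mxdotE; do 2 (apply: sumr_ge0 => ? _); rewrite -expr2 sqr_ge0.
Qed.

Lemma fro_ge0 A : 0 <= fro A.
Proof. exact: sqrtr_ge0. Qed.

Lemma fro_sqr A : fro A ^+ 2 = mxdot A A.
Proof. by rewrite sqr_sqrtr// mxdot_ge0. Qed.

Lemma mxdot_le A B : mxdot A B <= fro A * fro B.
Proof.
exact: (cauchy_schwarz_form mxdotC mxdotDl mxdotZl mxdot_ge0).
Qed.

Lemma froZ a A : fro (a *: A) = `|a| * fro A.
Proof.
by rewrite /fro mxdotZl mxdotZr mulrA -expr2 sqrtrM ?sqr_ge0// sqrtr_sqr.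
Qed.

Lemma froN A : fro (- A) = fro A.
Proof. by rewrite -scaleN1r froZ normrN1 mul1r. Qed.

Lemma fro0 : fro (0 : 'M[R]_(m, n)) = 0.
Proof. by rewrite /fro mxdot0l sqrtr0. Qed.

Lemma mxdot_ge A B : - (fro A * fro B) <= mxdot A B.
Proof. by rewrite lerNl -mxdotNl -(froN A) mxdot_le. Qed.

Lemma froD A B : fro (A + B) <= fro A + fro B.
Proof. exact: (triangle_form mxdotC mxdotDl mxdotZl mxdot_ge0). Qed.

Lemma froB A B : fro (A - B) <= fro A + fro B.
Proof. by rewrite -(froN B) froD. Qed.

Lemma fro_sum I r (P : pred I) (F : I -> 'M[R]_(m, n)) :
  fro (\sum_(i <- r | P i) F i) <= \sum_(i <- r | P i) fro (F i).
Proof.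
elim/big_ind2 : _ => [|A a B b Aa Bb|//]; first by rewrite fro0.
by rewrite (le_trans (froD _ _))// lerD.
Qed.

Lemma fro_ler A B : (forall i j, `|A i j| <= `|B i j|) -> fro A <= fro B.
Proof.
move=> AB; rewrite ler_wsqrtr// !mxdotE.
do 2 (apply: ler_sum => ? _); rewrite -!expr2 -real_normK ?num_real//.
by rewrite -[leRHS]real_normK ?num_real// lerXn2r ?nnegrE.
Qed.


End Matrices.

Lemma fro_trmx m n (A : 'M[R]_(m, n)) : fro A^T = fro A.
Proof. by rewrite /fro /mxdot trmxK mxtrace_mulC. Qed.

Section Blocks.
Context {N K : nat}.
Implicit Types U V W : blocks R N K.

Lemma blockB U V i : (U - V) i = U i - V i.
Proof. by rewrite ffunE [X in _ + X]ffunE. Qed.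

Lemma bdotC U V : bdot U V = bdot V U.
Proof. by apply: eq_bigr => i _; rewrite mxdotC. Qed.

Lemma bdotDl U V W : bdot (U + V) W = bdot U W + bdot V W.
Proof.
by rewrite /bdot -big_split/=; apply: eq_bigr => i _; rewrite ffunE mxdotDl.
Qed.

Lemma bdotZl a U V : bdot (a *: U) V = a * bdot U V.
Proof.
by rewrite /bdot mulr_sumr; apply: eq_bigr => i _; rewrite ffunE mxdotZl.
Qed.

Lemma bdotDr U V W : bdot U (V + W) = bdot U V + bdot U W.
Proof. by rewrite bdotC bdotDl !(bdotC U). Qed.

Lemma bdotZr a U V : bdot U (a *: V) = a * bdot U V.
Proof. by rewrite bdotC bdotZl bdotC. Qed.

Lemma bdotNl U V : bdot (- U) V = - bdot U V.
Proof. by rewrite -scaleN1r bdotZl mulN1r. Qed.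

Lemma bdotNr U V : bdot U (- V) = - bdot U V.
Proof. by rewrite -scaleN1r bdotZr mulN1r. Qed.

Lemma bdot0l U : bdot 0 U = 0.
Proof. by rewrite -(scale0r U) bdotZl mul0r. Qed.

Lemma bdot_suml I r (P : pred I) (F : I -> blocks R N K) U :
  bdot (\sum_(i <- r | P i) F i) U = \sum_(i <- r | P i) bdot (F i) U.
Proof.
by apply: (big_morph (fun X => bdot X U)) => [X Y|]; rewrite ?bdotDl ?bdot0l.
Qed.

Lemma bdot_sumr I r (P : pred I) (F : I -> blocks R N K) U :
  bdot U (\sum_(i <- r | P i) F i) = \sum_(i <- r | P i) bdot U (F i).
Proof. by rewrite bdotC bdot_suml; under eq_bigr do rewrite bdotC. Qed.

Lemma bdot_ge0 U : 0 <= bdot U U.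
Proof. by apply: sumr_ge0 => i _; exact: mxdot_ge0. Qed.

Lemma bnorm_ge0 U : 0 <= bnorm U.
Proof. exact: sqrtr_ge0. Qed.

Lemma bnorm_sqr U : bnorm U ^+ 2 = \sum_i fro (U i) ^+ 2.
Proof.
by rewrite sqr_sqrtr ?bdot_ge0//; apply: eq_bigr => i _; rewrite fro_sqr.
Qed.

Lemma bdot_le U V : bdot U V <= bnorm U * bnorm V.
Proof. exact: (cauchy_schwarz_form bdotC bdotDl bdotZl bdot_ge0). Qed.

Lemma bnormN U : bnorm (- U) = bnorm U.
Proof. by rewrite /bnorm bdotNl bdotNr opprK. Qed.

Lemma bnormBC U V : bnorm (U - V) = bnorm (V - U).
Proof. by rewrite -bnormN opprB. Qed.

Lemma bnorm0 : bnorm (0 : blocks R N K) = 0.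
Proof. by rewrite /bnorm bdot0l sqrtr0. Qed.

Lemma bdot_ge U V : - (bnorm U * bnorm V) <= bdot U V.
Proof. by rewrite lerNl -bdotNl -(bnormN U) bdot_le. Qed.

Lemma bdot_norm_le U V : `|bdot U V| <= bnorm U * bnorm V.
Proof. by rewrite ler_norml bdot_ge bdot_le. Qed.

Lemma bnormD U V : bnorm (U + V) <= bnorm U + bnorm V.
Proof. exact: (triangle_form bdotC bdotDl bdotZl bdot_ge0). Qed.

Lemma bnorm_dist V U W : bnorm (U - W) <= bnorm (U - V) + bnorm (V - W).
Proof. by rewrite (le_trans _ (bnormD _ _))// addrA subrK. Qed.

Lemma fro_le_bnorm U i : fro (U i) <= bnorm U.
Proof.
rewrite ler_wsqrtr// /bdot (bigD1 i)//= lerDl.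
by apply: sumr_ge0 => j _; exact: mxdot_ge0.
Qed.

Lemma bnorm_le_sum U : bnorm U <= \sum_i fro (U i).
Proof.
have h0 : 0 <= \sum_i fro (U i) by apply: sumr_ge0 => i _; exact: fro_ge0.
rewrite -[leRHS]ger0_norm// -sqrtr_sqr ler_wsqrtr//.
rewrite expr2 mulr_suml; apply: ler_sum => i _; rewrite -fro_sqr expr2.
apply: ler_wpM2l; first exact: fro_ge0.
by rewrite (bigD1 i)//= lerDl; apply: sumr_ge0 => j _; exact: fro_ge0.
Qed.

Lemma sum_fro_le_bnorm U : \sum_i fro (U i) <= Num.sqrt N.-1%:R * bnorm U.
Proof.
have h0 : 0 <= \sum_i fro (U i) by apply: sumr_ge0 => i _; exact: fro_ge0.
rewrite -[leLHS]ger0_norm// -sqrtr_sqr -sqrtrM ?ler0n// ler_wsqrtr//.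
have -> : bdot U U = \sum_i fro (U i) ^+ 2.
  by apply: eq_bigr => i _; rewrite fro_sqr.
set a := fun i => fro (U i); rewrite -/(a _).
have -> : N.-1%:R * (\sum_i a i ^+ 2) =
    2^-1 * \sum_i \sum_j (a i ^+ 2 + a j ^+ 2).
  under [in RHS]eq_bigr => i _ do rewrite big_split /= sumr_const card_ord.
  by rewrite big_split /= sumr_const card_ord sumrMnl -mulr_natl; field.
rewrite expr2 mulr_suml mulr_sumr; apply: ler_sum => i _.
rewrite !mulr_sumr; apply: ler_sum => j _.
by have := sqr_ge0 (a i - a j); rewrite -/(a i) -/(a j); lra.
Qed.

End Blocks.
End TraceInnerProduct.

(** * Symmetry of the Coulomb matrix *)

Section CoulombSymmetry.
Context {R : realType}.

(** The cubes of side [2 * n] centred at the origin exhaust the space. *)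
Lemma leb_sigma_finite d : sigma_finite [set: d.-tuple R] (leb d).
Proof.
exists (fun n => [set x : d.-tuple R | forall i,
    [set` `[- n%:R, n%:R]%R] (tnth x i)]).
  apply/seteqP; split => // x _.
  exists (Num.bound (\sum_i `|tnth x i|)) => //= i.
  rewrite in_itv /= -ler_norml; apply: le_trans (ltW (unstable.ltr_bound _)).
  rewrite (bigD1 i)//= lerDl.
  by apply: sumr_ge0 => j _.
move=> n; split.
  by apply: (@measurable_box R d (fun=> [set` `[- n%:R, n%:R]%R])) => i.
rewrite (@leb_box R d (fun=> [set` `[- n%:R, n%:R]%R]))//.
rewrite ltey_eq prode_fin_num// => i _; rewrite lebesgue_measure_itv /=.
by case: ifPn => // _; rewrite -EFinN -EFinD.
Qed.

(** [leb d] is a measure by recursion on [d]; this alias carries in addition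
    the sigma-finiteness that Tonelli's theorem asks for. *)
Definition lebesgue d : set (d.-tuple R) -> \bar R := leb d.
Arguments lebesgue : clear implicits.

HB.instance Definition _ d := Measure.on (lebesgue d).

HB.instance Definition _ d :=
  @Measure_isSigmaFinite.Build _ _ _ (lebesgue d) (leb_sigma_finite d).

(** The real power with exponent -1 agrees with the inverse on nonnegative
    reals, also at 0, and is measurable. *)
Lemma measurable_edist_inv d : measurable_fun setT
  (fun z : d.-tuple R * d.-tuple R => (Defs.edist z.1 z.2)^-1).
Proof.
rewrite (_ : (fun _ => _) = (fun z : d.-tuple R * d.-tuple R =>
    Defs.edist z.1 z.2 `^ (-1))); last first.
  by apply/funext => z; rewrite powR_inv1// sqrtr_ge0.
apply: (measurableT_comp (@measurable_powR R _)).
apply: (measurableT_comp (continuous_measurable_fun (@sqrt_continuous R))).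
apply: measurable_sum => i; apply: measurable_funX; apply: measurable_funB.
- exact: (measurableT_comp (measurable_tnth i) measurable_fst).
- exact: (measurableT_comp (measurable_tnth i) measurable_snd).
Qed.

Lemma edistC d (x y : d.-tuple R) : Defs.edist x y = Defs.edist y x.
Proof. by congr Num.sqrt; apply: eq_bigr => i _; rewrite -sqrrN opprB. Qed.

(** Restricting the kernel to [A `*` B] turns both sides into iterated
    integrals over the whole space, where Tonelli's theorem applies. *)
Lemma iterated_coulombC d (A B : set (d.-tuple R)) :
  measurable A -> measurable B ->
  (\int[leb d]_(y in B) \int[leb d]_(x in A) ((Defs.edist x y)^-1)%:E
   = \int[leb d]_(y in A) \int[leb d]_(x in B) ((Defs.edist x y)^-1)%:E)%E.
Proof.
move=> mA mB.
pose g (z : d.-tuple R * d.-tuple R) :=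
  (((fun z => ((Defs.edist z.1 z.2)^-1)%:E) \_ (A `*` B)) z)%E.
have restrictE y : (((fun y => \int[leb d]_(x in A) ((Defs.edist x y)^-1)%:E) \_ B) y
    = \int[leb d]_x g (x, y))%E.
  rewrite /g /patch; case: ifPn => [yB|yB]; last first.
    rewrite integral0_eq// => x _; rewrite ifF//.
    by apply/negbTE; apply: contra yB => /set_mem[_ /mem_set].
  rewrite integral_mkcond; apply: eq_integral => x _; rewrite /patch /=.
  by rewrite in_setX yB andbT.
have restrictE' y : (((fun y => \int[leb d]_(x in B) ((Defs.edist x y)^-1)%:E) \_ A) y
    = \int[leb d]_x g (y, x))%E.
  rewrite /g /patch; case: ifPn => [yA|yA]; last first.
    rewrite integral0_eq// => x _; rewrite ifF//.
    by apply/negbTE; apply: contra yA => /set_mem[/mem_set].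
  rewrite integral_mkcond; apply: eq_integral => x _; rewrite /patch /=.
  by rewrite in_setX yA /= edistC.
rewrite integral_mkcond [RHS]integral_mkcond.
under eq_integral do rewrite restrictE.
under [RHS]eq_integral do rewrite restrictE'.
symmetry; apply: (@fubini_tonelli _ _ _ _ _ (lebesgue d) (lebesgue d) g) => [|z].
  apply: (measurable_restrictT _ (measurableX mA mB)).1.
  have /measurable_EFinP mh := @measurable_edist_inv d.
  exact: measurable_funTS mh.
by rewrite /g /patch; case: ifP => // _; rewrite lee_fin invr_ge0 sqrtr_ge0.
Qed.

Lemma coulomb_sym d K (el : 'I_K -> set (d.-tuple R)) :
  (forall k, measurable (el k)) -> (coulomb el)^T = coulomb el.
Proof.
move=> mel; apply/matrixP => j k; rewrite !mxE eq_sym.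
by case: eqVneq => // jk; rewrite [X in X^-1]mulrC iterated_coulombC.
Qed.

End CoulombSymmetry.

(** * The objective as a quadratic form *)

Section SpectralNorm.
Context {R : realType}.

Lemma normr_mx_le_fro m n (A : 'M[R]_(m, n)) i j : `|A i j| <= fro A.
Proof.
rewrite -sqrtr_sqr ler_wsqrtr// mxdotE (bigD1 i)//= (bigD1 j)//= -expr2 -addrA.
rewrite lerDl addr_ge0// !sumr_ge0// => k _; rewrite ?sumr_ge0// => *;
  by rewrite -expr2 sqr_ge0.
Qed.

Lemma fro_eq0 m n (A : 'M[R]_(m, n)) : fro A = 0 -> A = 0.
Proof.
move=> A0; apply/matrixP => i j; rewrite mxE; apply/eqP.
by rewrite -normr_le0 -A0 normr_mx_le_fro.
Qed.

Lemma norm2_mx_has_sup m n (A : 'M[R]_(m, n)) :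
  has_sup [set fro (A *m x) | x in [set x : 'cV[R]_n | fro x <= 1]].
Proof.
split; first by exists (fro (A *m (0 : 'cV_n))); exists 0 => //=; rewrite fro0.
exists (\sum_j fro (col j A)) => _ [x /= x1 <-].
have -> : A *m x = \sum_j x j 0 *: col j A.
  apply/matrixP => i j; rewrite mxE summxE; apply: eq_bigr => k _.
  by rewrite !mxE mulrC ord1.
rewrite (le_trans (fro_sum _ _ _))//; apply: ler_sum => j _; rewrite froZ.
rewrite -[leRHS]mul1r ler_wpM2r ?fro_ge0//.
exact: le_trans (normr_mx_le_fro _ _ _) x1.
Qed.

Lemma norm2_mx_ge0 m n (A : 'M[R]_(m, n)) : 0 <= norm2_mx A.
Proof.
apply: (le_trans (fro_ge0 (A *m (0 : 'cV_n)))).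
by apply: (sup_upper_bound (norm2_mx_has_sup A)); exists 0 => //=; rewrite fro0.
Qed.

Lemma fro_mulmx_col m n (A : 'M[R]_(m, n)) (x : 'cV[R]_n) :
  fro (A *m x) <= norm2_mx A * fro x.
Proof.
have [x0|x0] := eqVneq (fro x) 0.
  by rewrite (fro_eq0 x0) mulmx0 !fro0 mulr0.
have xgt0 : 0 < fro x by rewrite lt_neqAle eq_sym x0 fro_ge0.
have xV0 : 0 <= (fro x)^-1 by rewrite invr_ge0 ltW.
rewrite -(ler_pdivrMr _ _ xgt0) mulrC -(ger0_norm xV0) -froZ scalemxAr.
apply: (sup_upper_bound (norm2_mx_has_sup A)).
by exists ((fro x)^-1 *: x) => //=; rewrite froZ ger0_norm// mulVf.
Qed.

Lemma fro_mulmxl m n p (A : 'M[R]_(m, n)) (B : 'M[R]_(n, p)) :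
  fro (A *m B) <= norm2_mx A * fro B.
Proof.
have fro_cols q (D : 'M[R]_(q, p)) : fro D ^+ 2 = \sum_j fro (col j D) ^+ 2.
  rewrite fro_sqr mxdotE exchange_big; apply: eq_bigr => j _.
  rewrite fro_sqr mxdotE; apply: eq_bigr => i _.
  by rewrite big_ord1 !mxE.
rewrite -[leRHS]ger0_norm ?mulr_ge0 ?norm2_mx_ge0 ?fro_ge0//.
rewrite -[leLHS]ger0_norm ?fro_ge0// -!sqrtr_sqr ler_wsqrtr//.
rewrite exprMn !fro_cols mulr_sumr; apply: ler_sum => j _.
rewrite -exprMn lerXn2r ?nnegrE ?mulr_ge0 ?norm2_mx_ge0 ?fro_ge0//.
by rewrite colE -mulmxA -colE fro_mulmx_col.
Qed.

Lemma fro_diag_mull n p (v : 'cV[R]_n) (B : 'M[R]_(n, p)) :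
  fro (diag_mx v^T *m B) <= `|v| * fro B.
Proof.
rewrite -[X in X * _]normr_id -froZ; apply: fro_ler => i j.
rewrite mul_diag_mx !mxE !normrM normr_id ler_wpM2r//.
rewrite /Num.Def.normr/= mx_normrE.
exact: (le_bigmax _ (fun ij => `|v ij.1 ij.2|) (i, 0)).
Qed.

Lemma fro_diag_mulr n p (v : 'cV[R]_n) (B : 'M[R]_(p, n)) :
  fro (B *m diag_mx v^T) <= fro B * `|v|.
Proof.
by rewrite -fro_trmx trmx_mul tr_diag_mx -(fro_trmx B) mulrC fro_diag_mull.
Qed.

End SpectralNorm.

Section Interaction.
Context {R : realType} (N K : nat).
Context (e vrho : 'cV[R]_K) (C : 'M[R]_K) (beta : R).
Context (Csym : C^T = C) (beta_gt0 : 0 < beta).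

Local Notation Lambda := (diag_mx vrho^T).
Local Notation Xi := (diag_mx e^T).
Local Notation blocks := (blocks R N K).
Local Notation fbeta := (@fbeta R N K e vrho C beta).
Local Notation M := (cst_M e vrho C beta).

(** The bilinear coupling of two blocks in [fbeta] is [mxdot U (L V)]. *)
Definition interaction (X : 'M[R]_K) : 'M[R]_K :=
  Xi *m Lambda *m X *m Xi *m C *m Xi + beta *: X.

Local Notation L := interaction.

Lemma interactionD X Y : L (X + Y) = L X + L Y.
Proof. by rewrite /interaction mulmxDr !mulmxDl scalerDr addrACA. Qed.

Lemma interactionZ a X : L (a *: X) = a *: L X.
Proof.
by rewrite /interaction -scalemxAr -!scalemxAl scalerDr !scalerA mulrC.
Qed.

Lemma interaction0 : L 0 = 0.
Proof. by rewrite -[X in L X](scale0r 0) interactionZ scale0r. Qed.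

Lemma interactionB X Y : L (X - Y) = L X - L Y.
Proof. by rewrite -(scaleN1r Y) interactionD interactionZ scaleN1r. Qed.

Lemma interaction_sum I r (P : pred I) (X : I -> 'M[R]_K) :
  L (\sum_(i <- r | P i) X i) = \sum_(i <- r | P i) L (X i).
Proof. exact: (big_morph _ interactionD interaction0). Qed.

(** Both [Xi *m Lambda] and [Xi *m C *m Xi] are symmetric. *)
Lemma mxdot_interaction X Y : mxdot (L X) Y = mxdot X (L Y).
Proof.
rewrite /interaction mxdotDl mxdotDr mxdotZl mxdotZr; congr (_ + _).
rewrite /mxdot !trmx_mul !tr_diag_mx Csym (diag_mxC e^T) -!mulmxA.
by do 3 rewrite mxtrace_mulC -!mulmxA.
Qed.

Lemma cst_M_ge0 : 0 <= M.
Proof.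
apply: addr_ge0; last exact: ltW.
by do 2 (apply: mulr_ge0 => //; rewrite ?exprn_ge0 ?norm2_mx_ge0//).
Qed.

Lemma fro_interaction X : fro (L X) <= M * fro X.
Proof.
rewrite (le_trans (froD _ _))// mulrDl lerD//; last first.
  by rewrite froZ ger0_norm// ltW.
rewrite (le_trans (fro_diag_mulr _ _))//.
have mulC (Y : 'M[R]_K) : fro (Y *m C) <= fro Y * norm2_mx C.
  by rewrite -fro_trmx trmx_mul Csym -(fro_trmx Y) mulrC fro_mulmxl.
apply: (@le_trans _ _ (`|e| * (`|vrho| * fro X) * `|e| * norm2_mx C * `|e|));
  last by rewrite le_eqVlt; apply/orP; left; apply/eqP; ring.
apply: ler_wpM2r => //. apply: (le_trans (mulC _)).
apply: ler_wpM2r; first exact: norm2_mx_ge0.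
apply: (le_trans (fro_diag_mulr _ _)); apply: ler_wpM2r => //.
rewrite -mulmxA; apply: (le_trans (fro_diag_mull _ _)).
by apply: ler_wpM2l => //; exact: fro_diag_mull.
Qed.

Lemma mxdot_interaction_le X Y : `|mxdot (L X) Y| <= M * (fro X * fro Y).
Proof.
apply: (@le_trans _ _ (fro (L X) * fro Y)).
  by rewrite ler_norml mxdot_ge mxdot_le.
by rewrite mulrA ler_wpM2r ?fro_ge0 ?fro_interaction.
Qed.

Definition hess (V : blocks) : blocks :=
  [ffun i => \sum_(j | j != i) L (V j)].

Definition grad (X : blocks) : blocks :=
  [ffun=> Lambda *m Xi *m C *m Xi] + hess X.

Lemma hessD U V : hess (U + V) = hess U + hess V.
Proof.
apply/ffunP => i; rewrite !ffunE -big_split; apply: eq_bigr => j _.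
by rewrite ffunE interactionD.
Qed.

Lemma hessZ a V : hess (a *: V) = a *: hess V.
Proof.
apply/ffunP => i; rewrite !ffunE scaler_sumr; apply: eq_bigr => j _.
by rewrite ffunE interactionZ.
Qed.

Lemma hessB U V : hess (U - V) = hess U - hess V.
Proof. by rewrite -(scaleN1r V) hessD hessZ scaleN1r. Qed.

Lemma hess_sum I r (P : pred I) (V : I -> blocks) :
  hess (\sum_(i <- r | P i) V i) = \sum_(i <- r | P i) hess (V i).
Proof.
apply: (big_morph _ hessD).
by rewrite -[X in hess X](scale0r 0) hessZ scale0r.
Qed.

Lemma gradB X Y : grad X - grad Y = hess (X - Y).
Proof. by rewrite hessB opprD addrACA subrr add0r. Qed.

Lemma bdot_hessE U V :
  bdot (hess U) V = \sum_i \sum_(j | j != i) mxdot (L (U j)) (V i).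
Proof. by apply: eq_bigr => i _; rewrite ffunE mxdot_suml. Qed.

Lemma bdot_hess U V : bdot (hess U) V = bdot U (hess V).
Proof.
rewrite bdot_hessE bdotC bdot_hessE (exchange_big_dep xpredT)//=.
apply: eq_bigr => j _; apply: eq_big => [i|i _]; first by rewrite eq_sym.
by rewrite mxdot_interaction mxdotC.
Qed.

(** In the quadratic form every unordered pair of blocks occurs twice. *)
Lemma bdot_hess_half V :
  bdot (hess V) V =
    2 * \sum_(i < N.-1) \sum_(j < N.-1 | (i < j)%N) mxdot (V i) (L (V j)).
Proof.
rewrite bdot_hessE mulr_natl mulr2n.
under eq_bigr => i _ do rewrite (bigID (fun j : 'I__ => (i < j)%N))/=.
rewrite big_split/=; congr (_ + _); last rewrite [RHS](exchange_big_dep xpredT)//=.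
  apply: eq_bigr => i _; apply: eq_big => [j|j _]; last by rewrite mxdotC.
  by rewrite -val_eqE/= neq_ltn; case: ltngtP.
apply: eq_bigr => i _; apply: eq_big => [j|j _].
  by rewrite -val_eqE/= neq_ltn -leqNgt; case: ltngtP.
by rewrite mxdot_interaction.
Qed.

Lemma fbetaE X :
  fbeta X = bdot [ffun=> Lambda *m Xi *m C *m Xi] X + 2^-1 * bdot (hess X) X.
Proof.
rewrite bdot_hess_half mulrA mulVf// mul1r /fbeta -addrA; congr (_ + _).
  by apply: eq_bigr => i _; rewrite ffunE mxdotC.
rewrite mulr_sumr -big_split; apply: eq_bigr => i _ /=.
rewrite mulr_sumr -big_split; apply: eq_bigr => j _ /=.
by rewrite mxdotDr mxdotZr.
Qed.

Lemma fbeta_expansion X V :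
  fbeta (X + V) = fbeta X + bdot (grad X) V + 2^-1 * bdot (hess V) V.
Proof.
rewrite !fbetaE hessD !bdotDl !bdotDr (bdotC (hess V) X) -bdot_hess.
by field.
Qed.

(** A crude Lipschitz constant of the gradient, sharp enough for limits. *)
Definition smoothness : R := N.-1%:R * (M * Num.sqrt N.-1%:R).

Lemma smoothness_ge0 : 0 <= smoothness.
Proof. by rewrite !mulr_ge0 ?sqrtr_ge0 ?ler0n ?cst_M_ge0. Qed.

Lemma bnorm_hess V : bnorm (hess V) <= smoothness * bnorm V.
Proof.
apply: (le_trans (bnorm_le_sum _)).
apply: (@le_trans _ _ (\sum_(i < N.-1) M * \sum_j fro (V j))).
  apply: ler_sum => i _; rewrite ffunE (le_trans (fro_sum _ _ _))//.
  rewrite mulr_sumr [leRHS](bigID (fun j => j != i))/=.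
  rewrite ler_wpDr ?sumr_ge0// => [j _|]; last first.
    by apply: ler_sum => j _; exact: fro_interaction.
  by rewrite mulr_ge0 ?fro_ge0 ?cst_M_ge0.
rewrite sumr_const card_ord -mulr_natl /smoothness -!mulrA.
by rewrite !ler_wpM2l ?ler0n ?cst_M_ge0 ?sum_fro_le_bnorm.
Qed.

Lemma bdot_hess_le V : `|bdot (hess V) V| <= smoothness * bnorm V ^+ 2.
Proof.
by rewrite (le_trans (bdot_norm_le _ _))// expr2 mulrA ler_wpM2r
  ?bnorm_ge0 ?bnorm_hess.
Qed.

End Interaction.

(** * Criticality and the limiting subdifferential *)

Section Criticality.
Context {R : realType} (N K : nat).
Context (e vrho : 'cV[R]_K) (C : 'M[R]_K) (beta : R).
Context (Csym : C^T = C) (beta_gt0 : 0 < beta).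

Local Notation blocks := (blocks R N K).
Local Notation fbeta := (@fbeta R N K e vrho C beta).
Local Notation grad := (@grad R N K e vrho C beta).
Local Notation hess := (@hess R N K e vrho C beta).
Local Notation feasible := (@feasible R N K e vrho).
Local Notation cS := (cS e vrho).
Local Notation cB := (cB e vrho).
Local Notation F := (@cF R N K e vrho C beta).
Local Notation c := (@smoothness R N K e vrho C beta).

Lemma cBD U V : cB (U + V) = cB U + cB V.
Proof. by rewrite /cB linearD !mulmxDr linearD /= raddfD !add_row_mx. Qed.

Lemma cBZ a U : cB (a *: U) = a *: cB U.
Proof.
rewrite /cB linearZ /= -!scalemxAr linearZ /= -scale_scalar_mx.
by rewrite !scale_row_mx.
Qed.

Lemma cBB U V : cB (U - V) = cB U - cB V.
Proof. by rewrite -(scaleN1r V) cBD cBZ scaleN1r. Qed.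

Lemma cS_segment U V t : cS U -> cS V -> 0 <= t <= 1 -> cS (U + t *: (V - U)).
Proof.
move=> [BU U0] [BV V0] /andP[t0 t1]; split.
  by rewrite cBD cBZ cBB BU BV subrr scaler0 addr0.
move=> i j; rewrite !mxE (_ : _ + _ = (1 - t) * U i j + t * V i j); last ring.
by rewrite addr_ge0// mulr_ge0// subr_ge0.
Qed.

Lemma cF_feasible X : feasible X -> F X = (fbeta X)%:E.
Proof.
move=> SX; rewrite /cF big1 ?adde0// => i _.
by rewrite /indicator mem_set//; exact: SX.
Qed.

Lemma cF_infeasible X : ~ feasible X -> F X = +oo%E.
Proof.
move=> /existsNP[i SXi]; rewrite /cF (bigD1 i)//= /indicator memNset//.
rewrite [(+oo + _)%E]addye ?addey// -ltNye (@lt_le_trans _ _ 0%E)//.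
by apply: sume_ge0 => j _; case: ifP.
Qed.

Lemma feasible_cF X : (F X < +oo)%E -> feasible X.
Proof. by apply: contraPP => /cF_infeasible ->; rewrite ltxx. Qed.

(** [xi] lies in the sum of the gradient of [fbeta] and the normal cone of the
    feasible set at [X]. *)
Definition critical_up_to (X xi : blocks) : Prop :=
  feasible X /\ forall Y, feasible Y -> 0 <= bdot (grad X - xi) (Y - X).

(** The normal cone part of [xi] is nonpositive along feasible directions, so
    on feasible points the numerator of the difference quotient is at least
    the quadratic remainder of [fbeta]; elsewhere the quotient is infinite.
    Hence [xi] is even a Frechet subgradient. *)
Lemma critical_limiting_subdiff X xi :
  critical_up_to X xi -> limiting_subdiff F X xi.
Proof.
move=> [SX vi]; exists (fun=> X), (fun=> xi); split.
- by rewrite /bconverges subrr bnorm0; exact: cvg_cst.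
- exact: cvg_cst.
- move=> _; split; first by rewrite cF_feasible// ltry.
  apply/lee_addgt0Pr => eps eps0.
  have c0 : 0 < c + 1 by rewrite ltr_wpDl// smoothness_ge0.
  rewrite -leeBlDr// sub0e; apply: (@le_trans _ _ (ereal_inf _)); last first.
    apply: ereal_sup_ubound; exists (eps / (c + 1)); last reflexivity.
    by rewrite /= divr_gt0.
  apply: le_ereal_inf_tmp => _ [Y /= [YX Ynear] <-].
  have Y0 : 0 < bnorm (Y - X).
    rewrite lt_neqAle bnorm_ge0 andbT eq_sym; apply: contra_neq YX => YX0.
    apply/subr0_eq/ffunP => i; rewrite [RHS]ffunE; apply: fro_eq0.
    by apply/le_anti; rewrite fro_ge0 -YX0 fro_le_bnorm.
  have [SY|SY] := pselect (feasible Y); last first.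
    rewrite (cF_infeasible SY) (cF_feasible SX).
    rewrite [X in (X * _)%E](_ : _ = +oo%E)// gt0_mulye ?leey//.
    by rewrite lte_fin invr_gt0.
  rewrite !cF_feasible// -!EFinB -EFinM lee_fin ler_pdivlMr//.
  have := fbeta_expansion e vrho beta Csym X (Y - X).
  rewrite (_ : X + _ = Y) => [->|]; last by rewrite addrC subrK.
  have := vi _ SY; rewrite bdotDl bdotNl.
  have := bdot_hess_le e vrho Csym beta_gt0 (Y - X).
  rewrite ler_norml => /andP[h _].
  move: Ynear; rewrite ltr_pdivlMr// => Ynear.
  have : bnorm (Y - X) * (bnorm (Y - X) * (c + 1)) <= bnorm (Y - X) * eps.
    by rewrite ler_wpM2l ?bnorm_ge0 ?ltW.
  have := sqr_ge0 (bnorm (Y - X)).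
  by have := smoothness_ge0 N e vrho C beta_gt0; nra.
- by rewrite /bconverges subrr bnorm0; exact: cvg_cst.
Qed.

Lemma bdist0_le X xi : critical_up_to X xi ->
  (bdist (0%R : blocks) (limiting_subdiff F X) <= (bnorm xi)%:E)%E.
Proof.
move=> /critical_limiting_subdiff Fxi; apply: ereal_inf_lbound.
by exists xi => //; rewrite sub0r bnormN.
Qed.

End Criticality.

(** * The Lojasiewicz inequality for a quadratic on a polyhedron *)

Section QuadraticLojasiewicz.
Context {R : realType}.

(** If [h] is not in the row space of [H], the gradient has a fixed nonzero
    component modulo that space and stays away from 0. Otherwise [h] is
    [u *m H], the gradient is [w *m H] with [w = y + u] the displacement from the
    critical point [- u], and the height [2^-1 * mxdot (w *m H) w] depends on [w] only
    through [w *m H], by means of a generalized inverse of [H]. *)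
Lemma quadratic_lojasiewicz m (H : 'M[R]_m) (h : 'rV[R]_m) : H^T = H ->
  exists v delta kappa : R, [/\ 0 < delta, 0 <= kappa &
    forall y : 'rV[R]_m, fro (y *m H + h) < delta ->
      `|mxdot h y + 2^-1 * mxdot (y *m H) y - v| <=
        kappa * fro (y *m H + h) ^+ 2].
Proof.
move=> Hsym.
have mxdotH (x y : 'rV[R]_m) : mxdot (x *m H) y = mxdot x (y *m H).
  by rewrite /mxdot trmx_mul Hsym -!mulmxA mxtrace_mulC -mulmxA mxtrace_mulC.
have fro_mulr p (x : 'rV[R]_m) (A : 'M[R]_(m, p)) :
    fro (x *m A) <= norm2_mx A^T * fro x.
  by rewrite -fro_trmx trmx_mul -(fro_trmx x) fro_mulmxl.
have [hH|hH] := boolP (h <= H)%MS; last first.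
  move: hH; rewrite submxE => hcoker0.
  have hcoker : 0 < fro (h *m cokermx H).
    rewrite lt_neqAle fro_ge0 andbT eq_sym; apply: contra hcoker0 => /eqP.
    by move=> /fro_eq0 ->.
  set D := norm2_mx (cokermx H)^T.
  have D0 : 0 < D + 1 by rewrite ltr_wpDl// norm2_mx_ge0.
  exists 0, (fro (h *m cokermx H) / (D + 1)), 0; split=> // [|y].
    by rewrite divr_gt0.
  rewrite ltr_pdivlMr// => ysmall; exfalso.
  have := fro_mulr _ (y *m H + h) (cokermx H).
  rewrite mulmxDl -mulmxA mulmx_coker mulmx0 add0r -/D.
  by have := fro_ge0 (y *m H + h); nra.
pose u := h *m pinvmx H; pose G := pinvmx H.
have uH : u *m H = h by rewrite /u mulmxKpV.
exists (- (2^-1 * mxdot h u)), 1, (2^-1 * norm2_mx G^T); split=> // [|y _].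
  by rewrite mulr_ge0 ?norm2_mx_ge0.
pose w := y + u.
have -> : y *m H + h = w *m H by rewrite mulmxDl uH.
have -> : mxdot h y + 2^-1 * mxdot (y *m H) y - - (2^-1 * mxdot h u) =
    2^-1 * mxdot (w *m H) w.
  rewrite mulmxDl uH mxdotDl !mxdotDr (mxdotH y u) uH (mxdotC y h).
  by field.
have -> : mxdot (w *m H) w = mxdot (w *m H *m G) (w *m H).
  by rewrite -mxdotH -!(mulmxA w) mulmxKpV.
rewrite normrM ger0_norm// -mulrA ler_wpM2l//.
apply: (@le_trans _ _ (fro (w *m H *m G) * fro (w *m H))).
  by rewrite ler_norml mxdot_ge mxdot_le.
by rewrite expr2 mulrA ler_wpM2r ?fro_ge0.
Qed.

End QuadraticLojasiewicz.

(** A list of elements of [P] is extended as long as its span misses an element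
    of [P], which can happen only as often as the dimension grows. *)
Lemma spanning_family (F : fieldType) (V : vectType F) (P : V -> Prop) :
  exists m (b : 'I_m -> V), (forall l, P (b l)) /\
    forall v, P v -> exists y : 'I_m -> F, v = \sum_l y l *: b l.
Proof.
suff: forall k (X : seq V), (\dim {:V} - \dim <<X>> <= k)%N ->
    (forall x, x \in X -> P x) ->
    exists Y : seq V, (forall x, x \in Y -> P x) /\
      forall v, P v -> v \in <<Y>>%VS.
  move=> /(_ _ [::] (leqnn _))[//|Y [PY spanY]].
  exists (size Y), (fun l => Y`_l); split=> [l|v Pv].
    by apply: PY; rewrite mem_nth.
  have vY := spanY _ Pv; exists (fun l => coord (in_tuple Y) l v).
  exact: (coord_span (X := in_tuple Y)).
elim=> [|k IH] X dimX PX; have [all|/existsNP[v /not_implyP[Pv vX]]] :=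
    pselect (forall v, P v -> v \in <<X>>%VS).
- by exists X.
- exfalso; apply: vX; have /eqP dimE : \dim <<X>> == \dim {:V}.
    rewrite eqn_leq dimvS ?subvf//=.
    by move: dimX; rewrite leqn0 subn_eq0.
  suff -> : (<<X>> = {:V})%VS by rewrite memvf.
  by apply/eqP; rewrite eqEdim subvf dimE /=.
- by exists X.
apply: (IH (v :: X)) => [|x]; last by rewrite inE => /predU1P[->|/PX].
rewrite -ltnS (leq_trans _ dimX)// ltn_sub2l//.
  rewrite ltnNge; apply/negP => dimV; apply: vX.
  suff -> : (<<X>> = {:V})%VS by rewrite memvf.
  by apply/eqP; rewrite eqEdim subvf.
rewrite span_cons ltnNge; apply/negP => dimv; apply: vX.
have /eqP -> : (<<X>> == <[v]> + <<X>>)%VS by rewrite eqEdim addvSr.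
by rewrite memvE addvSl.
Qed.

Section LojasiewiczOnPolyhedron.
Context {R : realType} (N K : nat).
Context (e vrho : 'cV[R]_K) (C : 'M[R]_K) (beta : R).
Context (Csym : C^T = C).

Local Notation blocks := (blocks R N K).
Local Notation fbeta := (@fbeta R N K e vrho C beta).
Local Notation grad := (@grad R N K e vrho C beta).
Local Notation hess := (@hess R N K e vrho C beta).
Local Notation feasible := (@feasible R N K e vrho).
Local Notation cB := (cB e vrho).
Local Notation critical_up_to := (@critical_up_to R N K e vrho C beta).

Definition active_set (X : blocks) : {set 'I_N.-1 * ('I_K * 'I_K)} :=
  [set a | X a.1 a.2.1 a.2.2 == 0].

(** A point with active set [J] can move both ways along these directions
    inside the feasible set. *)
Definition face_direction (J : {set 'I_N.-1 * ('I_K * 'I_K)}) (V : blocks) :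
    Prop :=
  (forall i, cB (V i) = 0) /\ forall a, a \in J -> V a.1 a.2.1 a.2.2 = 0.

(** The step is the inverse of a number above all the ratios of [`|V|] to [X].
    An entry where [X] vanishes contributes the ratio 0, and there the sign
    of [V] is what matters. *)
Lemma feasible_moves X (V : blocks) : feasible X -> (forall i, cB (V i) = 0) ->
  (forall i a b, X i a b = 0 -> 0 <= V i a b) ->
  exists2 t : R, 0 < t & feasible (X + t *: V).
Proof.
move=> SX BV VJ.
pose ratio (a : 'I_N.-1 * ('I_K * 'I_K)) :=
  `|V a.1 a.2.1 a.2.2| / X a.1 a.2.1 a.2.2.
have ratio0 a : 0 <= ratio a.
  by rewrite divr_ge0//; have [_] := SX a.1; apply.
have T0 : 0 < 1 + \sum_a ratio a by rewrite ltr_pwDl// sumr_ge0.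
exists (1 + \sum_a ratio a)^-1; first by rewrite invr_gt0.
move=> i; have [BX X0] := SX i; rewrite !ffunE; split.
  by rewrite cBD cBZ BV scaler0 addr0.
move=> a b; rewrite !mxE; have [Xab|Xab] := eqVneq (X i a b) 0.
  by rewrite Xab add0r mulr_ge0 ?VJ// invr_ge0 ltW.
have Xgt0 : 0 < X i a b by rewrite lt_neqAle eq_sym Xab X0.
rewrite -lerBlDl sub0r -(ler_pM2l T0) mulrN mulVKf ?gt_eqF//.
have : ratio (i, (a, b)) <= 1 + \sum_a ratio a.
  rewrite (bigD1 (i, (a, b)))//= addrCA lerDl addr_ge0//.
  by rewrite sumr_ge0.
rewrite ler_pdivrMr//= => h.
by rewrite lerNl (le_trans _ h)// -normrN ler_norm.
Qed.

(** Both [V] and [- V] are feasible directions, so the variational inequality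
    is an equality along [V]. *)
Lemma critical_face_direction X xi V : critical_up_to X xi ->
  face_direction (active_set X) V -> bdot (grad X) V = bdot xi V.
Proof.
move=> [SX vi] faceV.
have ge0 W : face_direction (active_set X) W -> 0 <= bdot (grad X - xi) W.
  move=> [BW WJ]; have [i a b Xab|t t0 /vi] := feasible_moves SX BW.
    by have -> := WJ (i, (a, b)); rewrite // inE Xab.
  by rewrite (addrC X) addrK bdotZr pmulr_rge0.
apply/subr0_eq; rewrite -bdotNl -bdotDl; apply/le_anti.
rewrite ge0// andbT -oppr_ge0 -bdotNr ge0//; move: faceV => [BV VJ].
split=> [i|a aJ].
  by rewrite ffunE -scaleN1r cBZ BV scaler0.
by rewrite ffunE mxE VJ// oppr0.
Qed.

(** On the affine hull of a face, [fbeta] is a quadratic polynomial, and [xi]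
    dominates its gradient along the hull ([critical_face_direction]). Let [w]
    be the critical value of that polynomial, and suppose that the gradient is
    small enough for [quadratic_lojasiewicz]. If [w <= v], the height above [v]
    is at most the height above [w]. If [v < w], a value in the lower half of
    the interval from [v] to [w] is at least as far from [w] as from [v]. In
    both cases the height above [v] is at most the distance to [w]. If the
    gradient is not small, neither is [xi], while the height is less than
    [ek.1]. *)
Lemma lojasiewicz_on_face (J : {set 'I_N.-1 * ('I_K * 'I_K)}) (v : R) :
  exists ek : R * R, [/\ 0 < ek.1, 0 <= ek.2 &
    forall X xi, critical_up_to X xi -> active_set X = J ->
      v < fbeta X -> fbeta X < v + ek.1 ->
      fbeta X - v <= ek.2 * bnorm xi ^+ 2].
Proof.
have [[X0 [SX0 X0J]]|noX0] := pselect
    (exists X0, feasible X0 /\ active_set X0 = J); last first.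
  exists (1, 0); split=> //= X xi [SX _] XJ; exfalso; apply: noX0.
  by exists X.
have [m [b [bJ spanb]]] := spanning_family (face_direction J).
pose H : 'M[R]_m := \matrix_(l, k) bdot (hess (b l)) (b k).
pose h : 'rV[R]_m := \row_k bdot (grad X0) (b k).
have Hsym : H^T = H.
  by apply/matrixP => l k; rewrite !mxE bdot_hess// bdotC.
have [w0 [delta [kappa [delta0 kappa0 quad]]]] := quadratic_lojasiewicz h Hsym.
pose w := fbeta X0 + w0.
pose B := \sum_k bnorm (b k) * fro (delta_mx 0 k : 'rV[R]_m).
have B0 : 0 <= B.
  by apply: sumr_ge0 => k _; rewrite mulr_ge0 ?bnorm_ge0 ?fro_ge0.
have face X xi : critical_up_to X xi -> active_set X = J ->
    exists r : R, [/\ 0 <= r, r <= B * bnorm xi &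
      r < delta -> `|fbeta X - w| <= kappa * r ^+ 2].
  move=> crit XJ; have SX := crit.1.
  have faceXX0 : face_direction J (X - X0).
    split=> [i|a aJ].
      by rewrite !ffunE cBB (SX i).1 (SX0 i).1 subrr.
    rewrite !ffunE !mxE; move: (aJ); rewrite -{1}XJ inE => /eqP ->.
    by move: aJ; rewrite -X0J inE => /eqP ->; rewrite subrr.
  have [y XX0] := spanb _ faceXX0.
  pose yr : 'rV[R]_m := \row_l y l.
  have gradE : yr *m H + h = \row_k bdot xi (b k).
    apply/rowP => k; rewrite !mxE.
    rewrite -(critical_face_direction crit); last by rewrite XJ.
    rewrite -[grad X](subrK (grad X0)) gradB XX0 [RHS]bdotDl; congr (_ + _).
    rewrite hess_sum bdot_suml; apply: eq_bigr => l _.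
    by rewrite hessZ bdotZl !mxE.
  have rowdot (u : 'rV[R]_m) : mxdot u yr = \sum_k y k * u 0 k.
    by rewrite mxdotE big_ord1; apply: eq_bigr => k _; rewrite mxE mulrC.
  have linE : mxdot h yr = bdot (grad X0) (X - X0).
    rewrite rowdot XX0 bdot_sumr; apply: eq_bigr => k _.
    by rewrite mxE bdotZr.
  have quadE : mxdot (yr *m H) yr = bdot (hess (X - X0)) (X - X0).
    rewrite rowdot XX0 bdot_sumr hess_sum; apply: eq_bigr => k _.
    rewrite mxE bdotZr bdot_suml; congr (_ * _); apply: eq_bigr => l _.
    by rewrite hessZ bdotZl !mxE.
  exists (fro (yr *m H + h)); split; first exact: fro_ge0.
    rewrite gradE [X in fro X]row_sum_delta (le_trans (fro_sum _ _ _))//.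
    rewrite mulr_suml; apply: ler_sum => k _.
    rewrite froZ mxE mulrAC ler_wpM2r ?fro_ge0//.
    by rewrite mulrC bdot_norm_le.
  move=> /quad; congr (`|_| <= _); rewrite linE quadE.
  have := fbeta_expansion e vrho beta Csym X0 (X - X0).
  by rewrite (_ : X0 + _ = X) => [->|]; [rewrite /w; ring | rewrite addrC subrK].
pose eta := if w <= v then 1 else (w - v) / 2.
have eta0 : 0 < eta.
  by rewrite /eta; case: (leP w v) => vw; lra.
exists (eta, (kappa + eta / delta ^+ 2) * B ^+ 2); split => //=.
  by rewrite mulr_ge0 ?sqr_ge0// addr_ge0// divr_ge0 ?sqr_ge0// ltW.
move=> X xi crit XJ vX Xeta; have [r [r0 rB close]] := face _ _ crit XJ.
have rB2 : r ^+ 2 <= B ^+ 2 * bnorm xi ^+ 2.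
  by rewrite -exprMn lerXn2r ?nnegrE ?mulr_ge0 ?bnorm_ge0.
rewrite -mulrA; set s := B ^+ 2 * _ in rB2 *.
have s0 : 0 <= s by apply: le_trans rB2; rewrite sqr_ge0.
have ed0 : 0 <= eta / delta ^+ 2 by rewrite divr_ge0 ?sqr_ge0// ltW.
have [/close|deltar] := ltP r delta.
  have : kappa * r ^+ 2 <= kappa * s by rewrite ler_wpM2l.
  have : 0 <= eta / delta ^+ 2 * s by rewrite mulr_ge0.
  rewrite ler_norml mulrDl => h1 h2 /andP[h3 h4].
  have [vw|vw] := leP w v; first lra.
  have etaE : eta = (w - v) / 2 by rewrite /eta leNgt vw.
  by move: Xeta => /=; lra.
have : eta <= eta / delta ^+ 2 * r ^+ 2.
  rewrite mulrAC ler_pdivlMr ?exprn_gt0//; apply: ler_wpM2l; first exact: ltW.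
  by rewrite lerXn2r ?nnegrE ?(ltW delta0).
have : eta / delta ^+ 2 * r ^+ 2 <= eta / delta ^+ 2 * s by rewrite ler_wpM2l.
have : 0 <= kappa * s by rewrite mulr_ge0.
by rewrite mulrDl; lra.
Qed.

(** There are finitely many active sets, and the constants of
    [lojasiewicz_on_face] depend on nothing else. *)
Lemma lojasiewicz_feasible (v : R) :
  exists eta kappa : R, [/\ 0 < eta, 0 <= kappa &
    forall X xi, critical_up_to X xi -> v < fbeta X -> fbeta X < v + eta ->
      fbeta X - v <= kappa * bnorm xi ^+ 2].
Proof.
have [ek ekP] := choice (fun J => lojasiewicz_on_face J v).
exists (\big[Num.min/1]_J (ek J).1), (\sum_J (ek J).2); split.
- by elim/big_ind : _ => [//|x y x0 y0|J _]; [rewrite lt_min x0 | case: (ekP J)].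
- by apply: sumr_ge0 => J _; case: (ekP J).
move=> X xi crit vX Xeta; have [_ _ face] := ekP (active_set X).
apply: (@le_trans _ _ ((ek (active_set X)).2 * bnorm xi ^+ 2)).
  apply: face => //; apply: (lt_le_trans Xeta); rewrite lerD2l.
  exact: bigmin_le.
rewrite ler_wpM2r ?sqr_ge0// (bigD1 (active_set X))//= lerDl.
by apply: sumr_ge0 => J _; case: (ekP J).
Qed.

End LojasiewiczOnPolyhedron.

(** * Farkas' lemma and Karush-Kuhn-Tucker multipliers *)

Section FarkasLemma.
Context {R : realType} {m n : nat}.
Implicit Types (a g V : 'M[R]_(m, n)) (s : seq 'M[R]_(m, n)).

(** Bartl's induction on the number of inequalities: when an inequality
    [a] cannot be dropped, some [V0] satisfies the others and has [g] and [a]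
    negative at it; projecting along [V0] onto the kernel of [a] reduces to
    the other inequalities, and the coefficient of [a] read off afterwards is
    nonnegative because of the signs at [V0]. *)
Lemma farkas s g :
  (forall V, (forall a, a \in s -> 0 <= mxdot a V) -> 0 <= mxdot g V) ->
  exists2 l : nat -> R, (forall i, 0 <= l i) &
    g = \sum_(i < size s) l i *: s`_i.
Proof.
move En : (size s) => k; elim: k s En g => [|k IH] [|a s]//.
  move=> _ g gs; exists (fun=> 0) => //; rewrite big_ord0; apply: fro_eq0.
  have /(_ (- g)) := gs; rewrite mxdotNr -fro_sqr oppr_ge0 => g0.
  by apply/eqP; rewrite -sqrf_eq0 eq_le g0 ?sqr_ge0.
move=> [En] g gs.
have [drop|/existsNP[V0 /not_implyP[sV0 /negP]]] := pselect
    (forall V, (forall a, a \in s -> 0 <= mxdot a V) -> 0 <= mxdot g V).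
  have [l l0 ->] := IH s En g drop.
  exists (fun i => if i is i'.+1 then l i' else 0) => [[]//|].
  by rewrite big_ord_recl scale0r add0r.
rewrite -ltNge => gV0.
have aV0 : mxdot a V0 < 0.
  rewrite ltNge; apply/negP => aV0; move: gV0; rewrite ltNge gs// => x.
  by rewrite inE => /predU1P[->//|/sV0].
pose pr x := x - (mxdot x V0 / mxdot a V0) *: a.
pose pV V := V - (mxdot a V / mxdot a V0) *: V0.
have prE x V : mxdot (pr x) V = mxdot x (pV V).
  by rewrite mxdotDl mxdotDr mxdotNl mxdotNr mxdotZl mxdotZr; ring.
have apV V : mxdot a (pV V) = 0.
  by rewrite mxdotDr mxdotNr mxdotZr divfK ?subrr// lt_eqF.
have Enpr : size (map pr s) = k by rewrite size_map.
have [V prs|l l0 prg] := IH _ Enpr (pr g).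
  rewrite prE gs// => x; rewrite inE => /predU1P[->|xs]; first by rewrite apV.
  by rewrite -prE prs ?map_f.
pose c := (mxdot g V0 - \sum_(i < k) l i * mxdot s`_i V0) / mxdot a V0.
exists (fun i => if i is i'.+1 then l i' else c) => [[|i]//|].
  rewrite /c nmulr_lge0 ?invr_lt0// subr_le0 (le_trans (ltW gV0))//.
  by apply: sumr_ge0 => i _; rewrite mulr_ge0// sV0// mem_nth// En.
have {}prg : pr g = \sum_(i < k) l i *: pr s`_i.
  by rewrite prg; apply: eq_bigr => i _; rewrite (nth_map 0) ?En.
rewrite big_ord_recl /= -[LHS](subrK ((mxdot g V0 / mxdot a V0) *: a)).
rewrite -/(pr g) prg.
have -> : \sum_(i < k) l i *: pr s`_i = \sum_(i < k) l i *: s`_i -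
    ((\sum_(i < k) l i * mxdot s`_i V0) / mxdot a V0) *: a.
  rewrite mulr_suml scaler_suml -sumrB; apply: eq_bigr => i _.
  by rewrite [pr _]/(_ - _) scalerBr scalerA mulrA.
by rewrite /c mulrBl scalerBl -addrA [RHS]addrC [- _ + _]addrC.
Qed.


End FarkasLemma.


Section Multipliers.
Context {R : realType} (N K : nat).
Context (e vrho : 'cV[R]_K) (C : 'M[R]_K) (beta : R).

Local Notation blocks := (blocks R N K).
Local Notation grad := (@grad R N K e vrho C beta).
Local Notation cB := (cB e vrho).
Local Notation cB_adj := (cB_adj e vrho).

Lemma cB_adjD lam mu : cB_adj (lam + mu) = cB_adj lam + cB_adj mu.
Proof. by apply/matrixP => i j; rewrite !mxE mxdotDr. Qed.

Lemma cB_adjZ a lam : cB_adj (a *: lam) = a *: cB_adj lam.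
Proof. by apply/matrixP => i j; rewrite !mxE mxdotZr. Qed.

Lemma cB_adj0 : cB_adj 0 = 0.
Proof. by apply/matrixP => i j; rewrite !mxE mxdot0r. Qed.

Lemma mxdot_delta m n (A : 'M[R]_(m, n)) i j : mxdot (delta_mx i j) A = A i j.
Proof.
rewrite mxdotE (bigD1 i)//= (bigD1 j)//= mxE !eqxx mul1r.
rewrite !big1 ?addr0// => [k /negPf ki|l /negPf lj]; last first.
  by rewrite mxE lj andbF mul0r.
by rewrite big1// => l _; rewrite mxE ki mul0r.
Qed.

(** Farkas' lemma for the block [i]: a direction annihilated by the equality
    constraints ([lines], with both signs) and nonnegative where [X i] vanishes
    ([walls]) is a feasible direction, along which the gradient is nonnegative.
    Hence the gradient is a combination of lines and walls; the lines sum to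
    the image of the multiplier [lam], the walls to [Phi]. *)
Lemma critical_KKT (X : blocks) : critical_up_to e vrho C beta X 0 ->
  KKT_point e vrho C beta X.
Proof.
move=> [SX vi].
have multipliers i : exists lamPhi : 'rV[R]_(K + K + 1) * 'M[R]_K,
    [/\ grad X i = cB_adj lamPhi.1 + lamPhi.2, nonneg_mx lamPhi.2 &
      forall a b, lamPhi.2 a b * X i a b = 0].
  pose lines := [seq cB_adj (delta_mx 0 j) | j <- enum 'I_(K + K + 1)].
  pose walls := [seq (delta_mx p.1 p.2 : 'M[R]_K) | p <- enum 
    {: 'I_K * 'I_K} & X i p.1 p.2 == 0].
  have [V Vs|l l0 ->] := @farkas R K K (lines ++ map -%R lines ++ walls)
      (grad X i).
    pose W : blocks := [ffun j => if j == i then V else 0].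
    have BV : cB V = 0.
      apply/rowP => j; rewrite [RHS]mxE -mxdot_delta mxdotC cB_adjP mxdotC.
      have jlines : cB_adj (delta_mx 0 j) \in lines.
        by apply: map_f; rewrite mem_enum.
      apply/le_anti; rewrite -oppr_ge0 -mxdotNl !Vs// !mem_cat.
        by rewrite jlines.
      by rewrite (map_f -%R jlines) orbT.
    have [j|j a b|t t0 /vi] := @feasible_moves R N K e vrho X W SX.
    - by rewrite ffunE; case: ifP => // _; rewrite -(scale0r V) cBZ scale0r.
    - rewrite ffunE; case: eqP => [->|_ _]; last by rewrite mxE.
      move=> Xab; rewrite -mxdot_delta Vs// !mem_cat; apply/orP; right.
      apply/orP; right; apply/mapP; exists (a, b) => //.
      by rewrite mem_filter mem_enum andbT Xab.
    rewrite subr0 (addrC X) addrK bdotZr pmulr_rge0// /bdot (bigD1 i)//=.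
    rewrite big1 ?addr0 ?ffunE ?eqxx// => j /negPf ji.
    by rewrite [W j]ffunE ji mxdot0r.
  elim/big_ind : _ => [|U V [[lam Phi] /= [-> Phi0 PhiX]]|k _].
  - exists (0, 0) => /=; split=> [|a b|a b]; rewrite ?mxE ?mul0r//.
    by rewrite cB_adj0 addr0.
  - move=> [[mu Psi] /= [-> Psi0 PsiX]]; exists (lam + mu, Phi + Psi) => /=.
    split=> [|a b|a b]; first by rewrite cB_adjD addrACA.
      by rewrite mxE addr_ge0.
    by rewrite mxE mulrDl PhiX PsiX addr0.
  have : (lines ++ map -%R lines ++ walls)`_k \in
      lines ++ map -%R lines ++ walls by rewrite mem_nth.
  rewrite !mem_cat => /or3P[/mapP[j _ ->]|/mapP[_ /mapP[j _ ->] ->]|/mapP[[a b]]].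
  - exists (l k *: delta_mx 0 j, 0) => /=.
    split=> [|a b|a b]; rewrite ?mxE ?mul0r//.
    by rewrite cB_adjZ addr0.
  - exists (- l k *: delta_mx 0 j, 0) => /=.
    split=> [|a b|a b]; rewrite ?mxE ?mul0r//.
    by rewrite cB_adjZ addr0 scaleNr scalerN.
  rewrite mem_filter => /andP[/eqP /= Xab _] ->.
  exists (0, l k *: delta_mx a b) => /=; split=> [|a' b'|a' b'].
  - by rewrite cB_adj0 add0r.
  - by rewrite !mxE mulr_ge0// ler0n.
  rewrite !mxE; case: eqP => [->|_]; last by rewrite mulr0 mul0r.
  by case: eqP => [->|_]; rewrite ?Xab ?mulr0 ?mul0r.
have [lamPhi lamPhiP] := choice multipliers.
exists (fun i => (lamPhi i).1), (fun i => (lamPhi i).2) => i.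
have [gradE Phi0 PhiX] := lamPhiP i; have [BX X0] := SX i; split=> //.
rewrite -addrA -opprD -gradE; apply/eqP; rewrite subr_eq0; apply/eqP.
rewrite !ffunE -interaction_sum /interaction addrA.
by rewrite (diag_mxC e^T).
Qed.

End Multipliers.

(** * One sweep of the algorithm *)

Lemma fro_sqrD_scale (R : realType) m n (U V : 'M[R]_(m, n)) (t : R) :
  fro (U + t *: V) ^+ 2 = fro U ^+ 2 + 2 * t * mxdot U V + t ^+ 2 * fro V ^+ 2.
Proof.
rewrite !fro_sqr mxdotDl !mxdotDr !mxdotZl !mxdotZr (mxdotC V U); ring.
Qed.

Section OneSweep.
Context {R : realType} (N K : nat).
Context (e vrho : 'cV[R]_K) (C : 'M[R]_K) (beta sigma : R).
Context (N_ge3 : (3 <= N)%N) (Csym : C^T = C).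
Context (beta_gt0 : 0 < beta) (sigma_gt0 : 0 < sigma).

Local Notation blocks := (blocks R N K).
Local Notation fbeta := (@fbeta R N K e vrho C beta).
Local Notation grad := (@grad R N K e vrho C beta).
Local Notation hess := (@hess R N K e vrho C beta).
Local Notation L := (interaction e vrho C beta).
Local Notation feasible := (@feasible R N K e vrho).
Local Notation cS := (cS e vrho).
Local Notation M := (cst_M e vrho C beta).
Local Notation block_objective :=
  (@block_objective R N K e vrho C beta sigma).

Context (Zold Znew x : blocks).
Context (x_opt : forall i, cS (x i) /\ forall W, cS W ->
  block_objective Zold Znew i (x i) <= block_objective Zold Znew i W).

Definition mixed (i : 'I_N.-1) : blocks :=
  [ffun j : 'I_N.-1 => if (j < i)%N then Znew j else Zold j].

(** The gradient of [fbeta] at [x] minus that of the block problems at their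
    optima: each block problem has its own data [mixed i] and a proximal
    term. *)
Definition residual : blocks :=
  [ffun i => hess (x - mixed i) i - sigma *: (x i - Zold i)].

Lemma grad_residual i :
  (grad x - residual) i = grad (mixed i) i + sigma *: (x i - Zold i).
Proof.
rewrite blockB [residual i]ffunE -gradB blockB !opprB.
by rewrite addrCA subrKC addrC.
Qed.

(** First-order optimality: the block objective at [x i + t *: (W - x i)] is a
    quadratic polynomial in [t], minimal at 0 on the unit interval. The Hessian
    term vanishes since no block interacts with itself. *)
Lemma block_variational i W : cS W ->
  0 <= mxdot ((grad x - residual) i) (W - x i).
Proof.
move=> SW; have [Sx xmin] := x_opt i; rewrite grad_residual.
pose D := W - x i.
pose P0 : blocks := [ffun j : 'I_N.-1 => if (j < i)%N then Znew j
  else if j == i then x i else Zold j].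
pose E : blocks := [ffun j => if j == i then D else 0].
have bdotE U : bdot U E = mxdot (U i) D.
  rewrite /bdot (bigD1 i)//= ffunE eqxx big1 ?addr0// => j /negPf ji.
  by rewrite ffunE ji mxdot0r.
have hessE : bdot (hess E) E = 0.
  rewrite bdotE ffunE big1 ?mxdot0l// => j /negPf ji.
  by rewrite ffunE ji interaction0.
have gradP0 : grad P0 i = grad (mixed i) i.
  rewrite !ffunE; congr (_ + _); apply: eq_bigr => j /negPf ji.
  by rewrite !ffunE ji.
set a := mxdot _ _.
have aE : a = mxdot (grad (mixed i) i) D + sigma * mxdot (x i - Zold i) D.
  by rewrite -mxdotZl -mxdotDl.
have a_t t : 0 < t <= 1 -> 0 <= a + t * (sigma / 2 * fro D ^+ 2).
  move=> /andP[t0 t1]; rewrite -(pmulr_rge0 _ t0).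
  have St : cS (x i + t *: D) by apply: cS_segment => //; rewrite t1 ltW.
  have := xmin _ St; rewrite -subr_ge0.
  rewrite /block_objective (_ : [ffun _ => _] = P0 + t *: E); last first.
    apply/ffunP => j; rewrite !ffunE; case: ifP => [ji|_].
      by rewrite ifF ?scaler0 ?addr0//; apply/eqP => ij; rewrite ij ltnn in ji.
    by case: eqP => [_|_]; rewrite ?scaler0 ?addr0.
  rewrite -/P0 fbeta_expansion// hessZ !bdotZl !bdotZr hessE !mulr0 addr0.
  rewrite bdotE gradP0 (_ : x i + t *: D - Zold i = x i - Zold i + t *: D);
    last by rewrite addrAC.
  rewrite fro_sqrD_scale aE.
  by move=> h; apply: (le_trans h); rewrite le_eqVlt; apply/orP; left;
    apply/eqP; field.
have b0 : 0 <= sigma / 2 * fro D ^+ 2.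
  by rewrite mulr_ge0 ?sqr_ge0// divr_ge0// ltW.
rewrite leNgt; apply/negP => a0.
set b := sigma / 2 * _ in a_t b0.
have b1 : 0 < b - a by lra.
have /a_t : 0 < - a / (2 * (b - a)) <= 1.
  rewrite divr_gt0 ?mulr_gt0 ?oppr_gt0//= ler_pdivrMr ?mulr_gt0//; lra.
rewrite -(pmulr_lge0 _ (mulr_gt0 (ltr0n _ 2) b1)) mulrDl mulrAC divfK; first nra.
by rewrite gt_eqF// mulr_gt0.
Qed.

Lemma critical_residual : critical_up_to e vrho C beta x residual.
Proof.
split=> [i|Y SY]; first by have [] := x_opt i.
apply: sumr_ge0 => i _; have := @block_variational i (Y i) (SY i).
by rewrite (blockB Y).
Qed.

Lemma natr_pred : N%:R - 1 = N.-1%:R :> R.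
Proof. by rewrite -[in LHS](@prednK N) ?(ltn_trans _ N_ge3)// mulrSr addrK. Qed.

(** The blocks of [x - mixed i] are blocks of [x - Znew] or of [x - Zold]; Cauchy-Schwarz over the blocks gives the square
    root in [cst_C3]. *)
Lemma bnorm_residual : bnorm residual <=
  cst_C3 N e vrho C beta sigma * (bnorm (x - Znew) + bnorm (x - Zold)).
Proof.
have M0 := cst_M_ge0 e vrho C beta_gt0.
pose a j := fro ((x - Znew) j); pose b j := fro ((x - Zold) j).
have ab0 j : 0 <= a j + b j by rewrite addr_ge0 ?fro_ge0.
pose T := \sum_j (a j + b j).
have row i : fro (residual i) <= M * T + sigma * b i.
  rewrite ffunE (le_trans (froB _ _))// lerD//; last first.
    by rewrite froZ (ger0_norm (ltW sigma_gt0)) /b blockB.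
  rewrite ffunE (le_trans (fro_sum _ _ _))// mulr_sumr.
  rewrite [leRHS](bigID (fun j => j != i))/= ler_wpDr//.
    by apply: sumr_ge0 => j _; rewrite mulr_ge0.
  apply: ler_sum => j _; rewrite (le_trans (fro_interaction _ _ Csym _ _))//.
  rewrite ler_wpM2l// /a /b !ffunE.
  by case: ifP => _; rewrite ?lerDl ?lerDr fro_ge0.
apply: (le_trans (bnorm_le_sum _)).
apply: (le_trans (ler_sum _ (fun i _ => row i))).
rewrite big_split /= sumr_const card_ord -mulr_sumr -mulr_natl.
have bT : \sum_i b i <= T by apply: ler_sum => i _; rewrite lerDr fro_ge0.
apply: (@le_trans _ _ ((sigma + M * N.-1%:R) * T)).
  have := ler_wpM2l (ltW sigma_gt0) bT.
  by lra.
rewrite /cst_C3 natr_pred -mulrA ler_wpM2l//.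
  by rewrite addr_ge0 ?mulr_ge0 ?(ltW sigma_gt0).
by rewrite /T big_split mulrDr lerD// sum_fro_le_bnorm.
Qed.

(** With [D = xold - x], expand [fbeta] at [x]. By the variational inequality
    the linear term is at least [bdot residual D]. The part of the residual
    that comes from the blocks after [i] contains [- D], and cancels the second
    order term exactly. What remains is [sigma * bnorm D ^+ 2] and products of
    [D] with the errors, which Young's inequality separates. The sums over
    [j != i] are bounded by sums over all [j]; since [N] is at least 3, the
    factor [N - 1] that results is at most [2 * (N - 2)]. *)
Lemma descent xold : feasible xold ->
  cst_C0 N e vrho C beta sigma * bnorm (x - xold) ^+ 2
    - cst_C2 N e vrho C beta sigma *
      (bnorm (xold - Zold) ^+ 2 + bnorm (x - Znew) ^+ 2)
  <= fbeta xold - fbeta x.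
Proof.
move=> Sxold; pose D := xold - x.
pose eps := xold - Zold; pose eps' := x - Znew.
pose eta (i j : 'I_N.-1) := if (j < i)%N then eps' j else eps j.
have M0 := cst_M_ge0 e vrho C beta_gt0.
have vi : 0 <= bdot (grad x - residual) D by have [_ /(_ _ Sxold)] := critical_residual.
have := fbeta_expansion e vrho beta Csym x D.
rewrite (_ : x + D = xold) => [fE|]; last by rewrite addrC subrK.
have resE i : mxdot (residual i) (D i) =
    \sum_(j | j != i) mxdot (L (eta i j)) (D i)
    - \sum_(j < N.-1 | (i < j)%N) mxdot (D i) (L (D j))
    - sigma * mxdot (eps i) (D i) + sigma * fro (D i) ^+ 2.
  rewrite ffunE mxdotDl mxdotNl mxdotZl ffunE mxdot_suml -addrA.
  congr (_ + _); last first.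
    have -> : x i - Zold i = eps i - D i.
      by rewrite !blockB opprB [RHS]addrC subrKA.
    by rewrite mxdotDl mxdotNl fro_sqr; ring.
  rewrite [X in _ = _ - X](_ : _ = \sum_(j | j != i)
      (if (i < j)%N then mxdot (L (D j)) (D i) else 0)).
    rewrite -sumrB; apply: eq_bigr => j ji; rewrite /eta !ffunE.
    have [ij|ij|/val_inj ij] := ltngtP i j; last by rewrite ij eqxx in ji.
      rewrite -mxdotNl -mxdotDl -interactionB; congr (mxdot (L _) _).
      by rewrite opprB [RHS]addrC subrKA.
    by rewrite subr0.
  rewrite big_mkcond [RHS]big_mkcond; apply: eq_bigr => j _.
  rewrite mxdotC; have [ij|_|_] := ltngtP i j; rewrite ?if_same//.
  by rewrite -val_eqE/= gtn_eqF.
have main : fbeta xold - fbeta x >= \sum_i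
    (\sum_(j | j != i) mxdot (L (eta i j)) (D i)
     - sigma * mxdot (eps i) (D i) + sigma * fro (D i) ^+ 2).
  apply: (@le_trans _ _ (bdot residual D + 2^-1 * bdot (hess D) D)).
    rewrite bdot_hess_half// mulrA mulVf// mul1r -big_split /=.
    by apply: ler_sum => i _; rewrite resE; lra.
  by move: vi; rewrite fE bdotDl bdotNl; lra.
apply: le_trans main.
have normE (U : blocks) : bnorm U ^+ 2 = \sum_i fro (U i) ^+ 2 by exact: bnorm_sqr.
pose q := \sum_j (fro (eps j) ^+ 2 + fro (eps' j) ^+ 2).
have young i : - (M / 2 * (q + N.-1%:R * fro (D i) ^+ 2)
      + sigma / 2 * (fro (eps i) ^+ 2 + fro (D i) ^+ 2)) + sigma * fro (D i) ^+ 2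
    <= \sum_(j | j != i) mxdot (L (eta i j)) (D i)
     - sigma * mxdot (eps i) (D i) + sigma * fro (D i) ^+ 2.
  rewrite lerD2r opprD lerD//; last first.
    rewrite lerNl opprK -mulrA ler_wpM2l ?(ltW sigma_gt0)//.
    have := mxdot_le (eps i) (D i).
    by have := sqr_ge0 (fro (eps i) - fro (D i)); lra.
  rewrite lerNl -sumrN.
  apply: (@le_trans _ _ (\sum_(j | j != i) M / 2 *
      (fro (eps j) ^+ 2 + fro (eps' j) ^+ 2 + fro (D i) ^+ 2))).
    apply: ler_sum => j _; rewrite lerNl.
    have := mxdot_interaction_le e vrho Csym beta_gt0 (eta i j) (D i).
    rewrite ler_norml => /andP[h _]; apply: le_trans h.
    rewrite lerN2 -mulrA ler_wpM2l//.
    have etaE : fro (eta i j) ^+ 2 <= fro (eps j) ^+ 2 + fro (eps' j) ^+ 2.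
      by rewrite /eta; case: ifP => _; rewrite ?lerDl ?lerDr sqr_ge0.
    by have := sqr_ge0 (fro (eta i j) - fro (D i)); lra.
  rewrite -mulr_sumr ler_wpM2l ?divr_ge0//.
  apply: (@le_trans _ _ (\sum_j
      (fro (eps j) ^+ 2 + fro (eps' j) ^+ 2 + fro (D i) ^+ 2))).
    rewrite [leRHS](bigID (fun j => j != i))/= lerDl.
    by apply: sumr_ge0 => j _; rewrite !addr_ge0 ?sqr_ge0.
  by rewrite big_split /= sumr_const card_ord mulr_natl.
apply: le_trans (ler_sum _ (fun i _ => young i)).
rewrite big_split /= sumrN big_split /= -!mulr_sumr !big_split /= sumr_const.
rewrite card_ord -!mulr_sumr -[_ *+ N.-1]mulr_natl /q big_split /= -!normE.
rewrite (_ : bnorm (x - xold) = bnorm D); last by rewrite bnormBC.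
rewrite -/eps -/eps' /cst_C2 /cst_C1 /cst_C0.
have n2 : 2 <= N.-1%:R :> R.
  by rewrite ler_nat -ltnS prednK//; exact: ltn_trans N_ge3.
have NE : N%:R = N.-1%:R + 1 :> R by rewrite -natr_pred subrK.
rewrite NE; set n : R := N.-1%:R in n2 *.
set a := bnorm D ^+ 2; set b := bnorm eps ^+ 2; set c := bnorm eps' ^+ 2.
have a0 : 0 <= a := sqr_ge0 _; have b0 : 0 <= b := sqr_ge0 _.
have c0 : 0 <= c := sqr_ge0 _.
rewrite (_ : n + 1 - 1 = n) ?addrK//.
clearbody a b c.
have n0 : 0 <= n by lra.
have n1 : 0 <= n - 1 by lra.
have {}n2 : 0 <= n - 2 by lra.
have s0 : 0 <= sigma := ltW sigma_gt0.
have bc0 : 0 <= b + c by rewrite addr_ge0.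
have h1 : 0 <= M * (n - 2) * a by rewrite !mulr_ge0.
have h2 : 0 <= sigma * (n - 1) * (b + c) by rewrite !mulr_ge0.
have h3 : 0 <= M * n * (n - 2) * (b + c) by rewrite !mulr_ge0.
have h4 : 0 <= M * n * (b + c) by rewrite !mulr_ge0.
have h5 : 0 <= sigma * c by rewrite mulr_ge0.
by nra.
Qed.

End OneSweep.

(** * Sequences of finite length *)

Section FiniteLength.
Context {R : realType}.

(** One step of the Kurdyka-Lojasiewicz argument. [D] is the decrease of the
    function value and [Dpsi] that of the desingularized value, [t] is the
    slope of the desingularizing function and [u] bounds the step before, up
    to errors. The decrease is at most [C3 * u * Dpsi], and the inequality
    between geometric and arithmetic means splits the square root of this
    product with the weight [p]. *)
Lemma lojasiewicz_step (C0 C2 C3 p d u b D t Dpsi : R) :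
  0 <= C0 -> 0 <= C2 -> 0 <= C3 -> 0 < p -> 0 <= u -> 0 <= b -> 0 <= D ->
  C0 * d ^+ 2 <= D + C2 * b ^+ 2 ->
  1 <= t * (C3 * u) -> t * D <= Dpsi ->
  Num.sqrt C0 * d <= 1 / (4 * p) * u + p * C3 * Dpsi + Num.sqrt C2 * b.
Proof.
move=> C00 C20 C30 p0 u0 b0 D0 desc slope conc.
have C3u : 0 <= C3 * u by rewrite mulr_ge0.
have t0 : 0 <= t by rewrite leNgt; apply/negP => t0; nra.
have Dpsi0 : 0 <= Dpsi by apply: le_trans conc; rewrite mulr_ge0.
have Dle : D <= C3 * u * Dpsi.
  have : D <= t * D * (C3 * u) by nra.
  by have := ler_wpM2r C3u conc; lra.
set x := 1 / (4 * p) * u; set y := p * C3 * Dpsi.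
have x0 : 0 <= x by rewrite mulr_ge0// divr_ge0// mulr_ge0// ltW.
have y0 : 0 <= y by rewrite !mulr_ge0// ltW.
have xy : 4 * x * y = C3 * u * Dpsi by rewrite /x /y; field; rewrite gt_eqF.
have s0 : 0 <= Num.sqrt C2 * b by rewrite mulr_ge0 ?sqrtr_ge0.
have T0 : 0 <= x + y + Num.sqrt C2 * b by rewrite !addr_ge0.
apply: (le_trans (ler_norm _)); rewrite -[leRHS]ger0_norm//.
rewrite -!sqrtr_sqr ler_wsqrtr// exprMn sqr_sqrtr//.
have sE : (Num.sqrt C2 * b) ^+ 2 = C2 * b ^+ 2 by rewrite exprMn sqr_sqrtr.
have := sqr_ge0 (x - y); have : 0 <= (x + y) * (Num.sqrt C2 * b).
  by rewrite mulr_ge0 ?addr_ge0.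
move: sE; set w := Num.sqrt C2 * b; nra.
Qed.

(** The steps on the right are absorbed by those on the left because [a <= s];
    what remains telescopes. *)
Lemma length_bound (d e psi : nat -> R) (s a b c E : R) n :
  0 <= a -> a <= s -> 0 <= b -> 0 <= c ->
  (forall k, 0 <= d k) -> (forall k, 0 <= e k) -> (forall k, 0 <= psi k) ->
  (forall k, \sum_(i < k) e i <= E) ->
  (forall k, (k < n)%N -> s * d k.+1 <= a * (d k + e k + e k.+1)
     + b * (psi k - psi k.+1) + c * (e k.+1 + e k.+2)) ->
  (s - a) * \sum_(i < n) d i.+1 <= a * d 0%N + 2 * (a + c) * E + b * psi 0%N.
Proof.
move=> a0 a_le b0 c0 d0 e0 psi0 eE step.
have tele j : (j <= n)%N -> (s - a) * (\sum_(i < j) d i.+1) + a * d j + b * psi j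
    <= a * d 0%N + a * (\sum_(i < j) e i) + (a + c) * (\sum_(i < j) e i.+1)
       + c * (\sum_(i < j) e i.+2) + b * psi 0%N.
  elim: j => [_|j IH jn]; first by rewrite !big_ord0 !mulr0 !addr0 add0r.
  have := IH (ltnW jn); have := step _ jn.
  by rewrite !big_ord_recr /=; lra.
have := tele n (leqnn n).
have h0 := eE n.
have h1 : \sum_(i < n) e i.+1 <= E.
  by apply: le_trans (eE n.+1); rewrite big_ord_recl lerDr.
have h2 : \sum_(i < n) e i.+2 <= E.
  apply: le_trans (eE n.+2); rewrite !big_ord_recl addrA lerDr.
  by rewrite addr_ge0.
have := mulr_ge0 a0 (d0 n); have := mulr_ge0 b0 (psi0 n).
have := ler_wpM2l a0 h0; have := ler_wpM2l (addr_ge0 a0 c0) h1.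
have := ler_wpM2l c0 h2.
by lra.
Qed.

Lemma cvgr0_sum (I : Type) (r : seq I) (f : I -> nat -> R) :
  (forall i, f i k @[k --> \oo] --> 0) ->
  \sum_(i <- r) f i k @[k --> \oo] --> 0.
Proof.
move=> f0; elim: r => [|i r IH].
  by under eq_fun do rewrite big_nil; exact: cvg_cst.
under eq_fun do rewrite big_cons.
have h : f i k + \sum_(j <- r) f j k @[k --> \oo] --> (0 + 0 : R) by exact: cvgD.
by rewrite addr0 in h.
Qed.

Lemma cvgr_le0 (t : R) (u : nat -> R) :
  u @ \oo --> 0 -> (forall k, t <= u k) -> t <= 0.
Proof.
move=> u0 tu; rewrite -(cvg_lim _ u0)//; apply: limr_ge.
  by apply/cvg_ex; exists 0.
exact: nearW.
Qed.

Section BlockSequences.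
Context {N K : nat}.
Local Notation blocks := (blocks R N K).
Implicit Types (x : nat -> blocks).

Lemma bnorm_le_entries (U : blocks) :
  bnorm U <= \sum_i \sum_a \sum_b `|U i a b|.
Proof.
apply: (le_trans (bnorm_le_sum _)); apply: ler_sum => i _.
rewrite [X in fro X]matrix_sum_delta (le_trans (fro_sum _ _ _))//.
apply: ler_sum => a _; rewrite (le_trans (fro_sum _ _ _))//.
apply: ler_sum => b _; rewrite froZ /fro mxdot_delta mxE !eqxx sqrtr1.
by rewrite mulr1.
Qed.

Lemma normr_entry_le_bnorm (U : blocks) i a b : `|U i a b| <= bnorm U.
Proof. exact: le_trans (normr_mx_le_fro _ _ _) (fro_le_bnorm _ _). Qed.

(** Every entry is the partial sum of an absolutely convergent series. *)
Lemma bconverges_of_finite_length x (B : R) :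
  (forall n, \sum_(k < n) bnorm (x k.+1 - x k) <= B) ->
  exists xlim, bconverges x xlim.
Proof.
move=> xB.
have dcvg : cvgn (series (fun k => bnorm (x k.+1 - x k))).
  apply: nondecreasing_is_cvgn.
    by apply: nondecreasing_series => k _ _; exact: bnorm_ge0.
  by exists B => _ [n _ <-]; rewrite /series/= big_mkord.
have entry i a b : exists l : R, (fun k => x k i a b) @ \oo --> l.
  apply/cvg_ex; pose u k := x k i a b; rewrite -/u.
  have : cvgn (series (telescope u)).
    apply: normed_cvg; apply: series_le_cvg dcvg => k //=.
      exact: bnorm_ge0.
    have := normr_entry_le_bnorm (x k.+1 - x k) i a b.
    by rewrite blockB !mxE.
  move=> /cvg_ex[/= l ul]; apply/cvg_ex; exists (u 0%N + l).
  have h : u 0%N + series (telescope u) n @[n --> \oo] --> u 0%N + l.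
    by apply: cvgD => //; exact: cvg_cst.
  have uE : (fun n => u 0%N + series (telescope u) n) = u.
    by apply/funext => n; rewrite -eq_sum_telescope.
  by rewrite uE in h.
have [l lP] := choice (fun p : 'I_N.-1 * ('I_K * 'I_K) =>
  entry p.1 p.2.1 p.2.2).
pose X : blocks := [ffun i => \matrix_(a, b) l (i, (a, b))].
exists X; rewrite /bconverges.
apply: (@squeeze_cvgr _ _ _ _ (fun=> 0)
    (fun k => \sum_i \sum_a \sum_b `|(x k - X) i a b|)).
- by apply: nearW => k; rewrite bnorm_ge0 bnorm_le_entries.
- exact: cvg_cst.
apply: cvgr0_sum => i; apply: cvgr0_sum => a; apply: cvgr0_sum => b.
apply/norm_cvg0P; have /= h := lP (i, (a, b)).
under eq_fun => k do rewrite blockB !mxE /X ffunE mxE.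
have : x k i a b - l (i, (a, b)) @[k --> \oo] --> l (i, (a, b)) - l (i, (a, b)).
  by apply: cvgB => //; exact: cvg_cst.
by rewrite subrr.
Qed.

Lemma bconverges_trans x y X :
  bconverges x X -> (fun k => bnorm (x k - y k)) @ \oo --> 0 -> bconverges y X.
Proof.
move=> xX xy; rewrite /bconverges.
apply: (@squeeze_cvgr _ _ _ _ (fun=> 0)
    (fun k => bnorm (x k - y k) + bnorm (x k - X))).
- apply: nearW => k; rewrite bnorm_ge0 (le_trans (bnorm_dist (x k) _ _))//.
  by rewrite (bnormBC (y k)).
- exact: cvg_cst.
- have h : bnorm (x k - y k) + bnorm (x k - X) @[k --> \oo] --> (0 + 0 : R).
    exact: cvgD.
  by rewrite addr0 in h.
Qed.

End BlockSequences.
End FiniteLength.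

(** * Limits of approximately critical points *)

Section Limits.
Context {R : realType} (N K : nat).
Context (e vrho : 'cV[R]_K) (C : 'M[R]_K) (beta : R).
Context (Csym : C^T = C) (beta_gt0 : 0 < beta).

Local Notation blocks := (blocks R N K).
Local Notation fbeta := (@fbeta R N K e vrho C beta).
Local Notation grad := (@grad R N K e vrho C beta).
Local Notation hess := (@hess R N K e vrho C beta).
Local Notation feasible := (@feasible R N K e vrho).
Local Notation critical_up_to := (@critical_up_to R N K e vrho C beta).
Local Notation c := (@smoothness R N K e vrho C beta).

Lemma fbeta_cvg (x : nat -> blocks) X :
  bconverges x X -> fbeta (x k) @[k --> \oo] --> fbeta X.
Proof.
move=> xX; apply/subr_cvg0/norm_cvg0P; pose u k := bnorm (x k - X).
apply: (@squeeze_cvgr _ _ _ _ (fun=> 0)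
    (fun k => bnorm (grad X) * u k + c * (u k * u k))).
- apply: nearW => k; rewrite normr_ge0 /=.
  have := fbeta_expansion e vrho beta Csym X (x k - X).
  rewrite (_ : X + _ = x k) => [->|]; last by rewrite addrC subrK.
  have := bdot_norm_le (grad X) (x k - X).
  have := bdot_hess_le e vrho Csym beta_gt0 (x k - X).
  rewrite -/(u k) -expr2; set a := bdot (grad X) _; set b := bdot (hess _) _.
  have cu := mulr_ge0 (smoothness_ge0 N e vrho C beta_gt0) (sqr_ge0 (u k)).
  rewrite !ler_norml => /andP[h1 h2] /andP[h3 h4].
  by apply/andP; split; lra.
- exact: cvg_cst.
have h : bnorm (grad X) * u k + c * (u k * u k) @[k --> \oo] -->
    bnorm (grad X) * 0 + c * (0 * 0).
  by apply: cvgD; apply: cvgM => //; try exact: cvg_cst; apply: cvgM.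
by rewrite !mulr0 addr0 in h.
Qed.

Lemma feasible_limit (x : nat -> blocks) X :
  (forall k, feasible (x k)) -> bconverges x X -> feasible X.
Proof.
move=> Sx xX i; split=> [|a b].
  apply/rowP => j; apply/eqP; rewrite -subr_eq0 -normr_le0.
  pose w := cB_adj e vrho (delta_mx 0 j).
  have scaled0 : fro w * bnorm (x k - X) @[k --> \oo] --> 0.
    have h : fro w * bnorm (x k - X) @[k --> \oo] --> fro w * 0.
      by apply: cvgM => //; exact: cvg_cst.
    by rewrite mulr0 in h.
  apply: (cvgr_le0 scaled0) => k.
  have entryB (A B : 'rV[R]_(K + K + 1)) : A 0 j - B 0 j = (A - B) 0 j.
    by rewrite !mxE.
  rewrite -(Sx k i).1 distrC entryB -cBB -blockB -mxdot_delta mxdotC cB_adjP.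
  rewrite mulrC (@le_trans _ _ (fro ((x k - X) i) * fro w))//.
    by rewrite ler_norml mxdot_ge mxdot_le.
  by rewrite ler_wpM2r ?fro_ge0 ?fro_le_bnorm.
rewrite -oppr_le0; apply: (cvgr_le0 xX) => k.
have := normr_entry_le_bnorm (x k - X) i a b.
rewrite blockB !mxE ler_norml => /andP[_].
have [_ /(_ a b)] := Sx k i.
lra.
Qed.

(** In the decomposition of [bdot (grad X) (Y - X)] the first term is
    nonnegative by the variational inequality at [x k], and the others are
    bounded by the sequence that tends to 0. *)
Lemma critical_limit (x xi : nat -> blocks) X :
  (forall k, critical_up_to (x k) (xi k)) -> bconverges x X ->
  bnorm (xi k) @[k --> \oo] --> 0 -> critical_up_to X 0.
Proof.
move=> crit xX xi0.
split=> [|Y SY]; first by apply: feasible_limit xX => k; have [] := crit k.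
rewrite subr0 -oppr_le0; pose u k := bnorm (x k - X).
pose A := bnorm (Y - X); pose G := bnorm (grad X).
apply: (@cvgr_le0 _ _ (fun k => (bnorm (xi k) + c * u k) * (A + u k) + G * u k)).
  have h : (bnorm (xi k) + c * u k) * (A + u k) + G * u k @[k --> \oo] -->
      (0 + c * 0) * (A + 0) + G * 0.
    apply: cvgD; apply: cvgM => //; try apply: cvgD => //; try exact: cvg_cst.
    by apply: cvgM => //; exact: cvg_cst.
  by rewrite !mulr0 !addr0 mul0r in h.
move=> k; have [_ /(_ _ SY) vi] := crit k.
have gradE : bdot (grad X) (Y - X) = bdot (grad (x k) - xi k) (Y - x k)
    + bdot (xi k + hess (X - x k)) (Y - x k) + bdot (grad X) (x k - X).
  by rewrite -gradB -bdotDl subrKA subrKC -bdotDr subrKA.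
have h1 := bdot_ge (xi k + hess (X - x k)) (Y - x k).
have h2 := bdot_ge (grad X) (x k - X).
have h3 : bnorm (xi k + hess (X - x k)) <= bnorm (xi k) + c * u k.
  apply: (le_trans (bnormD _ _)); rewrite lerD2l /u bnormBC.
  exact: bnorm_hess.
have h4 : bnorm (Y - x k) <= A + u k.
  by rewrite (le_trans (bnorm_dist X _ _))// lerD2l bnormBC.
have h5 := ler_pM (bnorm_ge0 _) (bnorm_ge0 _) h3 h4.
by rewrite -/G -/(u k) in h2; rewrite gradE; lra.
Qed.

End Limits.

(** * Desingularizing functions *)

Section Desingularizing.
Context {R : realType}.

(** Difference quotients of a concave function at [s], taken to the left,
    are at most the slope of the chord from [t] to [s]; along the points
    [s + (t - s) / n.+1] they converge to the derivative. *)
Lemma desingularizing_concave (eta : \bar R) (phi : R -> R) s t :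
  desingularizing eta phi -> 0 < s -> (s%:E < eta)%E -> 0 <= t -> t <= s ->
  derive1 phi s * (s - t) <= phi s - phi t.
Proof.
move=> [_ conc _ _ diff] s0 seta t0; rewrite le_eqVlt => /predU1P[->|ts].
  by rewrite !subrr mulr0.
have [der _ _] := diff s (conj (ltW s0) seta) s0.
have teta : (t%:E < eta)%E by apply: lt_trans seta; rewrite lte_fin.
pose h n : R := (t - s) * harmonic n.
have harm0 n : 0 < harmonic n :> R by exact: harmonic_gt0.
have harm1 n : harmonic n <= 1 :> R by rewrite invf_le1 ?ltr0n// ler1n.
have h_neq0 n : h n != 0.
  by apply: mulf_neq0; [rewrite subr_eq0 lt_eqF | rewrite gt_eqF].
have h0 : h n @[n --> \oo] --> 0.
  have : h n @[n --> \oo] --> (t - s) * 0.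
    by apply: cvgM; [exact: cvg_cst | exact: cvg_harmonic].
  by rewrite mulr0.
have quot : (h n)^-1 *: (phi (h n + s) - phi s) @[n --> \oo] --> derive1 phi s.
  have := (cvgr_dnbhsP _ _ _).1 der h (conj h_neq0 h0).
  rewrite derive1E /derive (_ : (fun n => _) =
    (fun n => (h n)^-1 *: (phi (h n + s) - phi s)))//.
  by apply/funext => n /=; rewrite [(h n)%:A]mulr1.
have : derive1 phi s <= (phi t - phi s) / (t - s).
  rewrite -(cvg_lim _ quot)//; apply: limr_le.
    by apply/cvg_ex; exists (derive1 phi s).
  apply: nearW => n.
  have hn : h n < 0.
    by rewrite pmulr_llt0 ?subr_lt0.
  rewrite /= /GRing.scale/= mulrC ler_ndivrMr//.
  have ts0 : t - s != 0 by rewrite subr_eq0 lt_eqF.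
  rewrite (_ : _ * h n = harmonic n * (phi t - phi s)); last by rewrite /h; field.
  have := conc t s (harmonic n) (conj t0 teta) (conj (ltW s0) seta).
  rewrite (_ : harmonic n * t + _ = h n + s); last by rewrite /h; ring.
  by rewrite (ltW (harm0 n)) harm1 => /(_ isT); lra.
by rewrite ler_ndivlMr ?subr_lt0//; lra.
Qed.

End Desingularizing.

Section KLInequality.
Context {R : realType} (N K : nat).
Context (e vrho : 'cV[R]_K) (C : 'M[R]_K) (beta : R).
Context (Csym : C^T = C) (beta_gt0 : 0 < beta).

Local Notation blocks := (blocks R N K).
Local Notation fbeta := (@fbeta R N K e vrho C beta).
Local Notation feasible := (@feasible R N K e vrho).
Local Notation F := (@cF R N K e vrho C beta).

(** The distance from 0 to the subdifferential is at most the norm of any of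
    its elements. *)
Lemma kl_slope (Zmin X xi : blocks) eta U phi :
  KL_property_with F Zmin eta U phi -> feasible Zmin -> U X ->
  critical_up_to e vrho C beta X xi -> fbeta Zmin < fbeta X ->
  ((fbeta X - fbeta Zmin)%:E < eta)%E ->
  0 < derive1 phi (fbeta X - fbeta Zmin) /\
  1 <= derive1 phi (fbeta X - fbeta Zmin) * bnorm xi.
Proof.
move=> [eta0 _ des kl] SZ UX crit ZX Xeta; have SX := crit.1.
have gap0 : 0 < fbeta X - fbeta Zmin by rewrite subr_gt0.
have [_ _ _ _ /(_ _ (conj (ltW gap0) Xeta) gap0)[_ _ slope0]] := des.
split=> //; rewrite -lee_fin EFinM; have := kl X UX.
rewrite !cF_feasible// lte_fin => /(_ ZX) => kle.
apply: (le_trans (kle _)); last first.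
  by apply: lee_wpmul2l; [rewrite lee_fin ltW | exact: bdist0_le].
by rewrite addeC -lteBlDr// -EFinB.
Qed.

End KLInequality.

(** * The trajectory of the algorithm *)

Section Trajectory.
Context {R : realType} (N K : nat).
Context (e vrho : 'cV[R]_K) (C : 'M[R]_K) (beta sigma Fbar E : R).
Context (N_ge3 : (3 <= N)%N) (Csym : C^T = C).
Context (beta_gt0 : 0 < beta) (sigma_gt0 : 0 < sigma).

Local Notation blocks := (blocks R N K).
Local Notation fbeta := (@fbeta R N K e vrho C beta).
Local Notation feasible := (@feasible R N K e vrho).
Local Notation critical_up_to := (@critical_up_to R N K e vrho C beta).
Local Notation C0 := (cst_C0 N e vrho C beta sigma).
Local Notation C2 := (cst_C2 N e vrho C beta sigma).
Local Notation C3 := (cst_C3 N e vrho C beta sigma).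

Context (sigma_large : 2 * cst_M e vrho C beta * (N%:R - 2) < sigma).
Context (Z Zbar : nat -> blocks).
Context (Zbar_opt : block_optimal_sequence e vrho C beta sigma Z Zbar).

(** Starting the block optima at the initial point makes the first sweep a
    step like the others, except that this point need not be feasible. *)
Definition trajectory (k : nat) : blocks := if k is 0 then Z 0%N else Zbar k.

Local Notation x := trajectory.

Definition error (k : nat) : R := bnorm (x k - Z k).
Definition step (k : nat) : R := bnorm (x k.+1 - x k).
Definition step_residual (k : nat) : blocks :=
  residual e vrho C beta sigma (Z k) (Z k.+1) (x k.+1).

Local Notation xi := step_residual.

Context (values_noninc : forall k, fbeta (x k.+2) <= fbeta (x k.+1)).
Context (values_gt : forall k, Fbar < fbeta (x k.+1)).
Context (values_cvg : fbeta (x k.+1) @[k --> \oo] --> Fbar).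
Context (errors_le : forall n, \sum_(k < n) error k <= E).

Lemma error_ge0 k : 0 <= error k.
Proof. exact: bnorm_ge0. Qed.

Lemma step_ge0 k : 0 <= step k.
Proof. exact: bnorm_ge0. Qed.

Lemma error0 : error 0%N = 0.
Proof. by rewrite /error subrr bnorm0. Qed.

Lemma cst_C0_gt0 : 0 < C0.
Proof. by move: sigma_large; rewrite /cst_C0; lra. Qed.

Lemma N_minus1_ge1 : 1 <= N%:R - 1 :> R.
Proof.
have : 3 <= N%:R :> R by rewrite ler_nat.
by lra.
Qed.

Lemma cst_C2_ge0 : 0 <= C2.
Proof.
have N1 := N_minus1_ge1; have M0 := cst_M_ge0 e vrho C beta_gt0.
rewrite mulr_ge0//; first by lra.
have : 0 <= cst_M e vrho C beta * (N%:R - 2) by rewrite mulr_ge0//; lra.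
by move: sigma_gt0; rewrite /cst_C1; nra.
Qed.

Lemma cst_C3_ge0 : 0 <= C3.
Proof.
have N1 := N_minus1_ge1; have M0 := cst_M_ge0 e vrho C beta_gt0.
rewrite mulr_ge0 ?sqrtr_ge0// addr_ge0 ?(ltW sigma_gt0)// mulr_ge0//; lra.
Qed.

Lemma critical_trajectory k : critical_up_to (x k.+1) (xi k).
Proof. exact: (critical_residual Csym sigma_gt0 (Zbar_opt k)). Qed.

Lemma feasible_trajectory k : feasible (x k.+1).
Proof. by have [] := critical_trajectory k. Qed.

Lemma bnorm_step_residual k :
  bnorm (xi k) <= C3 * (step k + error k + error k.+1).
Proof.
apply: (le_trans (bnorm_residual e vrho N_ge3 Csym beta_gt0 sigma_gt0 _ _ _)).
rewrite ler_wpM2l ?cst_C3_ge0// addrC lerD2r.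
exact: bnorm_dist.
Qed.

Lemma trajectory_descent k : feasible (x k) ->
  C0 * step k ^+ 2 <=
    fbeta (x k) - fbeta (x k.+1) + C2 * (error k + error k.+1) ^+ 2.
Proof.
move=> /(descent N_ge3 Csym beta_gt0 sigma_gt0 (Zbar_opt k)).
rewrite -/(step k) -/(error k) -/(error k.+1).
have := cst_C2_ge0; have := mulr_ge0 (error_ge0 k) (error_ge0 k.+1).
nra.
Qed.

Lemma trajectory_step k (t p Dpsi : R) : 0 < p ->
  1 <= t * bnorm (xi k) -> 0 <= t ->
  t * (fbeta (x k.+1) - fbeta (x k.+2)) <= Dpsi ->
  Num.sqrt C0 * step k.+1 <=
    1 / (4 * p) * (step k + error k + error k.+1) + p * C3 * Dpsi
    + Num.sqrt C2 * (error k.+1 + error k.+2).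
Proof.
move=> p0 slope t0 conc; apply: (lojasiewicz_step _ _ _ p0 _ _ _ _ _ conc).
- exact: ltW cst_C0_gt0.
- exact: cst_C2_ge0.
- exact: cst_C3_ge0.
- by rewrite !addr_ge0 ?step_ge0 ?error_ge0.
- by rewrite addr_ge0 ?error_ge0.
- by rewrite subr_ge0.
- exact: trajectory_descent (feasible_trajectory k).
- apply: (le_trans slope); apply: ler_wpM2l => //.
  exact: bnorm_step_residual.
Qed.

Lemma tail_errors_le m n : \sum_(k < n) error (m + k)%N <= E.
Proof.
apply: le_trans (errors_le (m + n)%N).
rewrite big_split_ord /= lerDr.
by apply: sumr_ge0 => k _; exact: error_ge0.
Qed.

(** The trajectory may be long before the values enter the strip of
    [lojasiewicz_feasible]; afterwards [2 * Num.sqrt kappa * Num.sqrt s]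
    serves as desingularizing function of the height [s]. *)
Lemma trajectory_length : exists B, exists m, forall n,
  \sum_(k < n) step (m + k)%N <= B.
Proof.
have [eta [kappa' [eta0 kappa'0 loj]]] :=
  lojasiewicz_feasible N e vrho beta Csym Fbar.
pose kappa := kappa' + 1; have kappa0 : 0 < kappa by rewrite ltr_wpDl.
have [m mP] : exists m, forall k, (m <= k)%N -> fbeta (x k.+1) < Fbar + eta.
  have Feta : Fbar < Fbar + eta by rewrite ltrDl.
  by have [m _ mP] := cvgr_lt _ values_cvg _ Feta; exists m.
pose g k := fbeta (x k.+1) - Fbar.
have g0 k : 0 < g k by rewrite subr_gt0.
pose psi k := 2 * Num.sqrt kappa * Num.sqrt (g (m + k)%N).
pose s := Num.sqrt C0; have s0 : 0 < s by rewrite sqrtr_gt0 cst_C0_gt0.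
(* Any weight with [1 / (4 * p) < s] would do. *)
pose p := s^-1; have p0 : 0 < p by rewrite invr_gt0.
have step_le k : s * step (m + k.+1)%N <=
    1 / (4 * p) * (step (m + k)%N + error (m + k)%N + error (m + k.+1)%N)
    + p * C3 * (psi k - psi k.+1)
    + Num.sqrt C2 * (error (m + k.+1)%N + error (m + k.+2)%N).
  rewrite !addnS; set j := (m + k)%N.
  have gj0 : 0 < Num.sqrt (g j) by rewrite sqrtr_gt0.
  apply: (@trajectory_step j (Num.sqrt kappa / Num.sqrt (g j))) => //.
    rewrite mulrAC ler_pdivlMr// mul1r -[bnorm _]ger0_norm ?bnorm_ge0//.
    rewrite -sqrtr_sqr -sqrtrM ?(ltW kappa0)// ler_wsqrtr//.
    have := loj _ _ (critical_trajectory j) (values_gt j) (mP j (leq_addr _ _)).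
    by rewrite /kappa mulrDl mul1r -/(g j); have := sqr_ge0 (bnorm (xi j)); lra.
  have -> : fbeta (x j.+1) - fbeta (x j.+2) = g j - g j.+1 by rewrite /g; ring.
  rewrite /psi addnS -/j mulrAC ler_pdivrMr//.
  have gE i : g i = Num.sqrt (g i) ^+ 2 by rewrite sqr_sqrtr ?(ltW (g0 i)).
  rewrite [X in _ * (X - _)]gE [X in _ * (_ - X)]gE.
  have := mulr_ge0 (sqrtr_ge0 kappa)
    (sqr_ge0 (Num.sqrt (g j) - Num.sqrt (g j.+1))).
  by lra.
exists (((1 / (4 * p)) * step m + 2 * (1 / (4 * p) + Num.sqrt C2) * E
    + p * C3 * psi 0%N) / (s - 1 / (4 * p))), m.+1 => n.
have a_lt : 0 < s - 1 / (4 * p).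
  have -> : 1 / (4 * p) = s / 4 by rewrite /p; field; rewrite gt_eqF.
  by lra.
rewrite ler_pdivlMr// mulrC.
under eq_bigr do rewrite addSnnS.
have := @length_bound R (fun k => step (m + k)%N) (fun k => error (m + k)%N) psi
  s (1 / (4 * p)) (p * C3) (Num.sqrt C2) E n.
rewrite addn0; apply=> //.
- by rewrite divr_ge0// mulr_ge0// ltW.
- by rewrite -subr_ge0 ltW.
- by rewrite mulr_ge0 ?cst_C3_ge0// ltW.
- by move=> k; exact: step_ge0.
- by move=> k; exact: error_ge0.
- by move=> k; rewrite !mulr_ge0 ?sqrtr_ge0.
- by move=> k; exact: tail_errors_le.
Qed.

Lemma errors_cvg0 : error k @[k --> \oo] --> 0.
Proof.
apply: cvg_series_cvg_0; apply: nondecreasing_is_cvgn.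
  by apply: nondecreasing_series => k _ _; exact: error_ge0.
by exists E => _ [n _ <-]; rewrite /series/= big_mkord.
Qed.

Lemma trajectory_converges_critical :
  exists X, bconverges x X /\ critical_up_to X 0.
Proof.
have [B [m lengthB]] := trajectory_length.
have [X mX] : exists X, bconverges (fun k => x (k + m)%N) X.
  apply: (@bconverges_of_finite_length _ _ _ _ B) => n.
  apply: le_trans (lengthB n); apply: ler_sum => k _.
  by rewrite /step addSn addnC.
have xX : bconverges x X.
  by rewrite /bconverges -(cvg_shiftn m); exact: mX.
exists X; split=> //.
have x1X : bconverges (fun k => x k.+1) X.
  by rewrite /bconverges (cvg_shiftS (fun k => bnorm (x k - X))).
apply: (critical_limit Csym beta_gt0 critical_trajectory x1X).
apply: (@squeeze_cvgr _ _ _ _ (fun=> 0)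
  (fun k => C3 * (bnorm (x k.+1 - X) + bnorm (x k - X) + error k + error k.+1))).
- apply: nearW => k; rewrite bnorm_ge0 (le_trans (bnorm_step_residual k))//.
  rewrite ler_wpM2l ?cst_C3_ge0// !lerD2r (bnormBC (x k) X).
  exact: bnorm_dist.
- exact: cvg_cst.
have e1 : error k.+1 @[k --> \oo] --> 0 by rewrite (cvg_shiftS error); exact: errors_cvg0.
have h : C3 * (bnorm (x k.+1 - X) + bnorm (x k - X) + error k + error k.+1)
    @[k --> \oo] --> C3 * (0 + 0 + 0 + 0).
  apply: cvgM; first exact: cvg_cst.
  by do 2 (apply: cvgD => //; try exact: errors_cvg0); apply: cvgD.
by rewrite !addr0 mulr0 in h.
Qed.

Lemma converges_critical : exists X,
  [/\ bconverges Z X, bconverges x X & critical_up_to X 0].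
Proof.
have [X [xX crit]] := trajectory_converges_critical; exists X; split=> //.
exact: bconverges_trans xX errors_cvg0.
Qed.

Section Trapped.
Context (Zmin : blocks) (eta : \bar R) (U : set blocks) (phi : R -> R) (r p : R).

Local Notation gap := (fbeta (Z 0%N) - fbeta Zmin).

Context (Zmin_min : global_minimizer e vrho C beta Zmin).
Context (kl : KL_property_with (@cF R N K e vrho C beta) Zmin eta U phi).
Context (ballU : [set Y | bnorm (Y - Zmin) <= r] `<=` U).
Context (p_large : 1 / (2 * Num.sqrt C0) < p).
Context (SZ0 : feasible (Z 0%N)) (first_value : fbeta (x 1%N) <= fbeta (Z 0%N)).
Context (gap_lt : (gap%:E < eta)%E).
Context (r_large :
  cst_tC1 N e vrho C beta sigma p * phi gap
  + cst_tC2 N e vrho C beta sigma p * Num.sqrt gap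
  + cst_tC3 N e vrho C beta sigma p * E + bnorm (Z 0%N - Zmin) <= r).

Local Notation g k := (fbeta (x k.+1) - fbeta Zmin).

Lemma min_le_Fbar : fbeta Zmin <= Fbar.
Proof.
rewrite -(cvg_lim _ values_cvg)//; apply: limr_ge.
  by apply/cvg_ex; exists Fbar.
by apply: nearW => k; have [_] := Zmin_min; apply; exact: feasible_trajectory.
Qed.

Lemma values_le_first k : fbeta (x k.+1) <= fbeta (x 1%N).
Proof. by elim: k => // k; apply: le_trans. Qed.

Lemma above_min k : 0 < g k.
Proof. by rewrite subr_gt0 (le_lt_trans min_le_Fbar). Qed.

Lemma g_lt_eta k : ((g k)%:E < eta)%E.
Proof.
apply: le_lt_trans gap_lt; rewrite lee_fin lerD2r.
exact: le_trans (values_le_first k) first_value.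
Qed.

Lemma p_gt0 : 0 < p.
Proof.
by apply: le_lt_trans p_large; rewrite divr_ge0// mulr_ge0// sqrtr_ge0.
Qed.

Lemma cst_tC0_gt0 : 0 < cst_tC0 N e vrho C beta sigma p.
Proof.
rewrite /cst_tC0 subr_gt0; have s0 : 0 < Num.sqrt C0.
  by rewrite sqrtr_gt0 cst_C0_gt0.
have p0 := p_gt0.
have ps : 1 < p * (2 * Num.sqrt C0) by rewrite -ltr_pdivrMr ?mulr_gt0.
by rewrite ltr_pdivrMr ?mulr_gt0//; lra.
Qed.

Lemma desingularizing_phi : desingularizing eta phi.
Proof. by case: kl. Qed.

Lemma phi_g_ge0 k : 0 <= phi (g k).
Proof.
have [phi0 _ _ _ _] := desingularizing_phi.
by apply: phi0; split; [exact: ltW (above_min k) | exact: g_lt_eta].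
Qed.

Lemma phi_first_le : phi (g 0%N) <= phi gap.
Proof.
have g0le : g 0%N <= gap by rewrite lerD2r.
have gap0 : 0 < gap := lt_le_trans (above_min 0%N) g0le.
have [_ _ _ _ /(_ _ (conj (ltW gap0) gap_lt) gap0)[_ _ slope0]] :=
  desingularizing_phi.
have := desingularizing_concave desingularizing_phi gap0 gap_lt
  (ltW (above_min 0%N)) g0le.
have := mulr_ge0 (ltW slope0) (_ : 0 <= gap - g 0%N).
by rewrite subr_ge0 => /(_ g0le); lra.
Qed.

(** The initial point is feasible, so the descent estimate holds for the first
    sweep as well; it starts there without error. *)
Lemma first_step_le :
  Num.sqrt C0 * step 0%N <= Num.sqrt gap + Num.sqrt C2 * E.
Proof.
have gap0 : 0 <= gap by rewrite ltW// (lt_le_trans (above_min 0%N))// lerD2r.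
have e1E : error 1%N <= E.
  by have := errors_le 2%N; rewrite 2!big_ord_recr big_ord0/= error0 !add0r.
have E0 : 0 <= E := le_trans (error_ge0 1) e1E.
have := @trajectory_descent 0%N SZ0; rewrite error0 add0r => desc.
have C20 := cst_C2_ge0.
have T0 : 0 <= Num.sqrt gap + Num.sqrt C2 * E.
  by rewrite addr_ge0 ?mulr_ge0 ?sqrtr_ge0.
apply: (le_trans (ler_norm _)); rewrite -[leRHS]ger0_norm//.
rewrite -!sqrtr_sqr ler_wsqrtr// exprMn sqr_sqrtr ?(ltW cst_C0_gt0)//.
apply: (le_trans desc); rewrite sqrrD exprMn (sqr_sqrtr gap0) (sqr_sqrtr C20).
have h1 : C2 * error 1%N ^+ 2 <= C2 * E ^+ 2.
  by rewrite ler_wpM2l// lerXn2r ?nnegrE ?error_ge0.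
have h2 : 0 <= Num.sqrt gap * (Num.sqrt C2 * E) *+ 2.
  by rewrite mulrn_wge0// !mulr_ge0 ?sqrtr_ge0.
have h3 : fbeta (x 0%N) - fbeta (x 1%N) <= gap.
  by rewrite lerD2l lerN2 -subr_ge0 ltW// above_min.
by lra.
Qed.

(** As long as the trajectory stays in the ball, [trajectory_step] bounds the
    next step, so that [length_bound] controls the path up to the next point. *)
Lemma trapped n : bnorm (x n.+1 - Zmin) <= r - E.
Proof.
have E0 : 0 <= E by have := errors_le 0%N; rewrite big_ord0.
have s0 : 0 < Num.sqrt C0 by rewrite sqrtr_gt0 cst_C0_gt0.
have p0 := p_gt0; have tC00 := cst_tC0_gt0.
elim/ltn_ind: n => n IH.
(* The two error terms that accompany a step together weigh [2 * a], which is
   the [1 / (2 * p)] in the constants of the assumption. *)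
pose a := 1 / (4 * p).
have a0 : 0 < a by rewrite divr_gt0// mulr_gt0.
have q2a : 1 / (2 * p) = 2 * a by rewrite /a; field; rewrite gt_eqF.
have aC0 : 2 * a < Num.sqrt C0.
  by move: tC00; rewrite /cst_tC0 q2a subr_gt0.
have a_le : a <= Num.sqrt C0 by lra.
have b0 : 0 <= p * C3 by rewrite mulr_ge0 ?cst_C3_ge0 ?(ltW p0).
have steps k : (k < n)%N -> Num.sqrt C0 * step k.+1 <=
    a * (step k + error k + error k.+1)
    + p * C3 * (phi (g k) - phi (g k.+1))
    + Num.sqrt C2 * (error k.+1 + error k.+2).
  move=> kn; have Uk : U (x k.+1).
    by apply: ballU => /=; apply: (le_trans (IH k kn)); rewrite lerBlDr lerDl.
  have [slope0 slope1] := kl_slope Csym beta_gt0 kl Zmin_min.1 Uk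
    (critical_trajectory k) (le_lt_trans min_le_Fbar (values_gt k)) (g_lt_eta k).
  apply: (trajectory_step p0 slope1 (ltW slope0)).
  have -> : fbeta (x k.+1) - fbeta (x k.+2) = g k - g k.+1 by ring.
  apply: (desingularizing_concave desingularizing_phi (above_min k)).
  - exact: g_lt_eta.
  - exact: ltW (above_min _).
  - by rewrite lerD2r.
have := length_bound (ltW a0) a_le b0 (sqrtr_ge0 _) step_ge0 error_ge0
  phi_g_ge0 errors_le steps.
set S := \sum_(i < n) _ => lenS.
have S0 : 0 <= S by apply: sumr_ge0 => i _; exact: step_ge0.
have dist : bnorm (x n.+1 - Zmin) <= bnorm (Z 0%N - Zmin) + step 0%N + S.
  rewrite /S; elim: (n) => [|m IHm].
    by rewrite big_ord0 addr0 [leRHS]addrC; exact: bnorm_dist.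
  rewrite big_ord_recr /= addrA [leRHS]addrC.
  by rewrite (le_trans (bnorm_dist (x m.+1) _ _))// lerD2l.
apply: (le_trans dist); rewrite lerBrDr; apply: le_trans r_large.
(* [delta] bounds the first step and [W / T] the steps after it. *)
pose T := cst_tC0 N e vrho C beta sigma p.
pose delta := (Num.sqrt gap + Num.sqrt C2 * E) / Num.sqrt C0.
pose W := 2 * a * delta + (2 * a + 2 * Num.sqrt C2) * E + p * C3 * phi gap.
have step_delta : step 0%N <= delta by rewrite ler_pdivlMr// mulrC first_step_le.
have SW : S <= W / T.
  have TE : T = Num.sqrt C0 - 2 * a by rewrite /T /cst_tC0 q2a.
  rewrite ler_pdivlMr// TE; have := ler_wpM2l b0 phi_first_le.
  have := ler_wpM2l (ltW a0) step_delta; have := mulr_ge0 (ltW a0) S0.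
  have := mulr_ge0 (ltW a0) (le_trans (step_ge0 _) step_delta).
  by rewrite /W; lra.
have budget : cst_tC1 N e vrho C beta sigma p * phi gap
    + cst_tC2 N e vrho C beta sigma p * Num.sqrt gap
    + cst_tC3 N e vrho C beta sigma p * E = delta + W / T + E.
  rewrite /cst_tC3 /cst_tC2 /cst_tC1 -/T /W /delta /a; field.
  by rewrite !gt_eqF.
by rewrite budget; lra.
Qed.

(** At the limit 0 is a subgradient, so a value above the minimum would
    contradict the Kurdyka-Lojasiewicz inequality there. *)
Lemma trapped_limit_minimizer X : bconverges x X -> critical_up_to X 0 ->
  global_minimizer e vrho C beta X.
Proof.
move=> xX crit; have SX := crit.1; split=> // Y SY.
have x1X : bconverges (fun k => x k.+1) X.
  by rewrite /bconverges (cvg_shiftS (fun k => bnorm (x k - X))).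
have [_ Zmin_le] := Zmin_min; apply: le_trans (Zmin_le _ SY).
have UX : U X.
  apply: ballU; rewrite /= -subr_le0; apply: (cvgr_le0 x1X) => k.
  rewrite lerBlDr (le_trans (bnorm_dist (x k.+1) _ _))// bnormBC lerD2l.
  rewrite (le_trans (trapped k))// gerBl.
  by have := errors_le 0%N; rewrite big_ord0.
have fX : fbeta X = Fbar.
  have fcvg := fbeta_cvg Csym beta_gt0 x1X.
  by rewrite -(cvg_lim _ (fcvg _ _))// (cvg_lim _ values_cvg).
rewrite leNgt; apply/negP => minX.
have Xeta : ((fbeta X - fbeta Zmin)%:E < eta)%E.
  apply: le_lt_trans (g_lt_eta 0%N); rewrite lee_fin lerD2r fX.
  exact: ltW (values_gt _).
have [_] := kl_slope Csym beta_gt0 kl Zmin_min.1 UX crit minX Xeta.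
by rewrite bnorm0 mulr0 ler10.
Qed.

End Trapped.

End Trajectory.

(** * Convergence *)

Theorem theorem3p3 (R : realType) (N d K : nat)
    (Omega : set (d.-tuple R)) (el : 'I_K -> set (d.-tuple R))
    (rho : d.-tuple R -> R) (beta sigma : R)
    (Z Zbar : nat -> blocks R N K) (Fbar : R) :
  let e := volumes el in
  let vrho := density_averages el rho in
  let C := coulomb el in
  let F := cF (N := N) e vrho C beta in
  let err := fun k => bnorm (Zbar k - Z k) in
  let M := cst_M e vrho C beta in
  (3 <= N)%N -> (1 <= d <= 3)%N ->
  bounded_domain Omega -> partitioned Omega el ->
  (forall r, Omega r -> 0 <= rho r) ->
  (leb d).-integrable Omega (EFin \o rho) ->
  0 < beta -> 0 < sigma ->
  2 * M * (N%:R - 2) < sigma ->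
  block_optimal_sequence e vrho C beta sigma Z Zbar ->
  (forall k, (1 <= k)%N -> (F (Zbar k.+1) <= F (Zbar k))%E) ->
  (fun k => F (Zbar k)) @ \oo --> Fbar%:E ->
  0 < Fbar ->
  cvgn (fun n => \sum_(1 <= k < n) err k) ->
  (forall k, (1 <= k)%N -> (Fbar%:E < F (Zbar k))%E) ->
  (exists2 Zlim, bconverges Z Zlim & KKT_point e vrho C beta Zlim)
  /\
  (forall (Zmin : blocks R N K) (eta : \bar R) (U : set (blocks R N K))
     (phi : R -> R) (r p : R),
   global_minimizer e vrho C beta Zmin ->
   KL_property_with F Zmin eta U phi ->
   0 < r -> [set Y | bnorm (Y - Zmin) <= r] `<=` U ->
   1 / (2 * Num.sqrt (cst_C0 N e vrho C beta sigma)) < p ->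
   (* the monotone sequence of values starts at Zbar 0 := Z 0 *)
   (F (Zbar 1%N) <= F (Z 0%N))%E ->
   (F Zmin < F (Z 0%N))%E -> (F (Z 0%N) < F Zmin + eta)%E ->
   let gap := fine (F (Z 0%N)) - fine (F Zmin) in
   cst_tC1 N e vrho C beta sigma p * phi gap
     + cst_tC2 N e vrho C beta sigma p * Num.sqrt gap
     + cst_tC3 N e vrho C beta sigma p * limn (fun n => \sum_(1 <= k < n) err k)
     + bnorm (Z 0%N - Zmin) <= r ->
   exists2 Zlim, bconverges Z Zlim & global_minimizer e vrho C beta Zlim).
Proof.
move=> e vrho C F err M N3 _ _ [el_meas _ _ _] _ _ beta0 sigma0 sigmaM opt.
move=> Fnoninc Fcvg _ err_cvg Fgt.
have Csym : C^T = C by apply: coulomb_sym => k; have [] := el_meas k.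
have FZbar k : F (Zbar k.+1) = (fbeta e vrho C beta (Zbar k.+1))%:E.
  by rewrite /F cF_feasible// => i; have [] := opt k i.
have noninc k : fbeta e vrho C beta (trajectory Z Zbar k.+2)
    <= fbeta e vrho C beta (trajectory Z Zbar k.+1).
  by have := Fnoninc k.+1 isT; rewrite !FZbar lee_fin.
have gtF k : Fbar < fbeta e vrho C beta (trajectory Z Zbar k.+1).
  by have := Fgt k.+1 isT; rewrite FZbar lte_fin.
have cvgF : fbeta e vrho C beta (trajectory Z Zbar k.+1) @[k --> \oo] --> Fbar.
  move: Fcvg; rewrite -(cvg_shiftS (fun k => F (Zbar k))) => /fine_cvg.
  by apply: cvg_trans; apply: near_eq_cvg; apply: nearW => k /=; rewrite FZbar.
pose u n := \sum_(1 <= k < n) err k.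
have u_nondec : {homo u : m n / (m <= n)%N >-> m <= n}.
  apply/nondecreasing_seqP => -[|n]; first by rewrite /u !big_geq.
  by rewrite /u (@big_nat_recr _ _ _ n.+1)//= lerDl; exact: bnorm_ge0.
have errE n : \sum_(k < n) error Z Zbar k <= limn u.
  apply: (le_trans _ (nondecreasing_cvgn_le u_nondec err_cvg n)).
  case: n => [|n]; first by rewrite big_ord0 /u big_geq.
  by rewrite big_ord_recl error0 add0r /u big_add1 big_mkord.
have [X [ZX xX crit]] := converges_critical N3 Csym beta0 sigma0 sigmaM opt
  noninc gtF cvgF errE.
split; first by exists X => //; exact: critical_KKT.
move=> Zmin eta U phi r p minZ kl _ ballU p_large FZ1 _ FZ0eta gap r_large.
exists X => //.
have SZ0 : feasible e vrho (Z 0%N).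
  by apply: (feasible_cF (C := C) (beta := beta)); exact: lt_le_trans FZ0eta (leey _).
have gapE : gap = fbeta e vrho C beta (Z 0%N) - fbeta e vrho C beta Zmin.
  by rewrite /gap /F !cF_feasible//; exact: minZ.1.
rewrite FZbar /F cF_feasible// lee_fin in FZ1.
rewrite /F !cF_feasible// in FZ0eta; last exact: minZ.1.
apply: (trapped_limit_minimizer N3 Csym beta0 sigma0 sigmaM opt noninc gtF cvgF
  errE minZ kl ballU p_large SZ0 FZ1 _ _ xX crit).
  by rewrite EFinB lteBlDr// addeC.
by rewrite -gapE.
Qed.
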